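(* Let $r\geq 2$ and $n\geq 2r+1$ be integers, set $\alpha:=\left\lfloor \frac{n+1}{r+1}\right\rfloor$, and let $h_\alpha$ be the function defined in the context (with $m=\alpha$). If either - $n\geq r^2+3r+1$ and $h\leq \alpha\, h_\alpha(r-1)$, or - $n<r^2+3r+1$, $r$ is even, and $h\leq (\alpha-1)h_\alpha(r-1)+h_\alpha(n-2-\alpha r)$, or - $n<r^2+3r+1$, $r$ is odd, and $h\leq (\alpha-1)h_\alpha(r-2)+h_\alpha(\min\{n-3-\alpha(r-1),\,r-2\})$, then the Grassmannian $\mathbb{G}(r,n)$, in its Plücker embedding, is not $(h+1)$-defective.
   Context: We work over $\mathbb{C}$. $\mathbb{G}(r,n)$ is the Grassmannian of $r$-dimensional projective linear subspaces of $\mathbb{P}^n$, embedded in $\mathbb{P}^N=\mathbb{P}(\bigwedge^{r+1}\mathbb{C}^{n+1})$, $N=\binom{n+1}{r+1}-1$, by the Plücker embedding. Here $h$ is a non-negative integer. For an irreducible non-degenerate variety $X\subset\mathbb{P}^N$ and an integer $k\geq 1$, the $k$-secant variety $\mathbb{S}ec_k(X)\subset\mathbb{P}^N$ is the Zariski closure of the union of the linear spaces spanned by collections of $k$ points of $X$; $X$ is $k$-defective if $\dim \mathbb{S}ec_k(X)<\min\{k\dim X+k-1,\,N\}$. For an integer $m\geq 2$ the function $h_m:\mathbb{Z}_{\geq 0}\to\mathbb{Z}_{\geq 0}$ is defined by $h_m(0)=0$ and, for $k\geq 1$, writing $k+1=2^{\lambda_1}+\dots+2^{\lambda_l}+\varepsilon$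 with $\lambda_1>\dots>\lambda_l\geq 1$ and $\varepsilon\in\{0,1\}$, by $h_m(k)=m^{\lambda_1-1}+\dots+m^{\lambda_l-1}$. *)

(* Defs.v *)
From mathcomp Require Import all_boot all_order all_algebra.
From mathcomp Require Import boolp classical_sets reals constructive_ereal ereal.
From mathcomp Require Import complex.
(* The notations of mpoly clash with those of classical_sets. *)
From mathcomp Require Import -(notations) mpoly.

Set Implicit Arguments.
Unset Strict Implicit.
Unset Printing Implicit Defensive.

Import Order.TTheory GRing.Theory Num.Theory.

Local Open Scope classical_set_scope.
Local Open Scope ring_scope.

(* Each binary digit 1 of k + 1 at a position i >= 1 contributes m^(i-1);
   hfunE below is the description by the expansion of k + 1. *)
Definition hfun (m k : nat) : nat :=
  (\sum_(1 <= i < k.+2 | odd (k.+1 %/ 2 ^ i)) m ^ i.-1)%N.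

Section ProjectiveGeometry.
Variables (R : realType) (N : nat).

(* A point of P^N is a line of C^(N+1) through the origin. *)
Definition proj : Type := {L : {vspace 'rV[R[i]]_N.+1} | \dim L == 1%N}.

Definition vanishes_at (f : mpoly N.+1 R[i]) (p : proj) : Prop :=
  forall v, v \in val p -> meval (v 0) f = 0.

Definition zariski_closed (Z : set proj) : Prop :=
  exists2 E : set (mpoly N.+1 R[i]),
    (forall f, E f -> f \is ishomog mdeg)
    & Z = [set p | forall f, E f -> vanishes_at f p].

Definition zariski_closure (A : set proj) : set proj :=
  smallest zariski_closed A.

Definition closed_in (X F : set proj) : Prop :=
  exists2 Z, zariski_closed Z & F = X `&` Z.

Definition irreducible (X : set proj) : Prop :=
  X !=set0 /\
  forall Z1 Z2, zariski_closed Z1 -> zariski_closed Z2 ->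
    X `<=` Z1 `|` Z2 -> X `<=` Z1 \/ X `<=` Z2.

(* Only F 0, ..., F d matter. *)
Definition irreducible_chain (X : set proj) (d : nat) (F : nat -> set proj) :
    Prop :=
  (forall i, (i <= d)%N -> closed_in X (F i) /\ irreducible (F i)) /\
  (forall i, (i < d)%N -> F i `<` F i.+1).

(* Krull dimension; the empty set has dimension -oo. *)
Definition dimension (X : set proj) : \bar R :=
  ereal_sup [set (d%:R)%:E | d in [set d | exists F, irreducible_chain X d F]].

Definition secant_variety (k : nat) (X : set proj) : set proj :=
  zariski_closure
    [set q | exists2 p : 'I_k -> proj,
       forall i, X (p i) & (val q <= \sum_(i < k) val (p i))%VS].

Definition defective (k : nat) (X : set proj) : Prop :=
  (dimension (secant_variety k X) <
     Order.min ((k%:R)%:E * dimension X + (k%:R)%:E - 1) (N%:R)%:E)%E.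

End ProjectiveGeometry.

Section Grassmannian.
Variables (R : realType) (r n : nat).

Definition plucker_dim : nat := 'C(n.+1, r.+1).-1.

Definition plucker_index (k : 'I_plucker_dim.+1) : {set 'I_n.+1} :=
  nth finset.set0 (enum [pred S : {set 'I_n.+1} | #|S| == r.+1]) k.

(* The maximal minors of A. The columns in S are listed in increasing order. *)
Definition plucker_vec (A : 'M[R[i]]_(r.+1, n.+1)) :
    'rV[R[i]]_plucker_dim.+1 :=
  \row_k \det (colsub (fun j : 'I_r.+1 => nth ord0 (enum (plucker_index k)) j) A).

(* An r-plane of P^n is the row space of a row-free A; its image does not
   depend on A, as plucker_vec (B *m A) = \det B *: plucker_vec A. *)
Definition grassmannian : set (proj R plucker_dim) :=
  [set p | exists2 A : 'M[R[i]]_(r.+1, n.+1),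
     row_free A & val p = <[plucker_vec A]>%VS].

End Grassmannian.
Arguments grassmannian : clear implicits.

Section HfunExpansion.
Local Open Scope nat_scope.

Lemma sum_expn2_lt (l : nat) (s : seq nat) :
  path gtn l s -> \sum_(i <- s) 2 ^ i < 2 ^ l.
Proof.
elim: s l => [|a s IHs] l /=; first by rewrite big_nil expn_gt0.
case/andP=> lt_al /IHs lt_s; rewrite big_cons.
apply: leq_trans (_ : 2 ^ a.+1 <= _); last by rewrite leq_exp2l.
by rewrite expnS mul2n -addnn ltn_add2l.
Qed.

Lemma odd_sum_expn2 (s : seq nat) (i : nat) :
  sorted gtn s -> odd ((\sum_(l <- s) 2 ^ l) %/ 2 ^ i) = (i \in s).
Proof.
elim: s => [|l s IHs] /=; first by rewrite big_nil div0n.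
move=> ls; have lt_s := sum_expn2_lt ls.
rewrite big_cons inE; have IH := IHs (path_sorted ls).
case: (ltngtP i l) => [lt_il|lt_li|->] /=.
- have -> : 2 ^ l = 2 ^ (l - i).-1.+1 * 2 ^ i.
    by rewrite prednK ?subn_gt0 // -expnD subnK // ltnW.
  by rewrite divnMDl ?expn_gt0 // oddD IH expnS mul2n odd_double.
- rewrite divn_small.
    apply/esym/negbTE/negP=> i_s.
    have /allP/(_ _ i_s) /= := order_path_min (rev_trans ltn_trans) ls.
    by rewrite ltnNge (ltnW lt_li).
  apply: leq_trans (_ : 2 ^ l.+1 <= _); last by rewrite leq_exp2l.
  by rewrite expnS mul2n -addnn ltn_add2l.
- by rewrite -{1}[2 ^ l]mul1n divnMDl ?expn_gt0 // divn_small.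
Qed.

Lemma hfunE (m k : nat) (s : seq nat) (e : bool) :
  sorted gtn s -> all (leq 1) s ->
  k.+1 = \sum_(l <- s) 2 ^ l + e ->
  hfun m k = \sum_(l <- s) m ^ l.-1.
Proof.
move=> s_sorted s_gt0 def_k.
pose t := s ++ nseq e 0.
have t_sorted : sorted gtn t.
  rewrite /t; case: e {def_k t} => /=; last by rewrite cats0.
  case: s s_sorted s_gt0 => //= a s path_s a_gt0.
  rewrite cats1 rcons_path path_s /=.
  exact: (allP (a_gt0 : all (leq 1) (a :: s)) _ (mem_last a s)).
have sum_t : k.+1 = \sum_(l <- t) 2 ^ l.
  by rewrite def_k big_cat /=; case: (e);
    rewrite /= ?big_seq1 ?big_nil.
have memE i : odd (k.+1 %/ 2 ^ i) = (i \in t) by rewrite sum_t odd_sum_expn2.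
rewrite /hfun -big_filter; apply: perm_big; apply: uniq_perm.
- by rewrite filter_uniq ?iota_uniq.
- exact: (sorted_uniq (rev_trans ltn_trans) ltnn).
move=> i; rewrite mem_filter mem_index_iota memE mem_cat mem_nseq.
apply/idP/idP => [/and3P[/orP[//|/andP[_ /eqP->]]]//|i_s].
rewrite i_s /= (allP s_gt0) //= ltnS.
apply: leq_trans (ltnW (ltn_expl i (ltnSn 1))) _.
by rewrite def_k (big_rem i) //= -addnA leq_addr.
Qed.

Lemma hfun0 (m : nat) : hfun m 0 = 0.
Proof. by rewrite (@hfunE m 0 [::] true) ?big_nil. Qed.

End HfunExpansion.

(* Main.v *)
Require Import Defs.
From mathcomp Require Import all_boot all_order all_algebra.
From mathcomp Require Import reals.
From mathcomp Require Import boolp classical_sets constructive_ereal ereal.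
From mathcomp Require Import fingroup perm complex ring zify.
From mathcomp Require Import -(notations) mpoly.

(* Lower bound for the secant variety (Terracini): at coordinate points of the
   Grassmannian whose index sets pairwise meet in at most r - 2 elements the
   tangent spaces are spanned by disjoint sets of coordinate vectors. A code
   with h + 1 such index sets is obtained for r >= 6 by doubling the letters of
   words over Z/alpha and adding a check digit; r = 3, 4, 5 need one or two
   more index sets, and r = 2 needs one non-coordinate plane.

   Independent tangent spaces mean that the homogeneous parametrization psi of
   the cone over the secant variety is an immersion at some point. Restricting
   psi to a flag of linear subspaces through that point gives the required
   chain of irreducible closed sets: it is strict because s + 1 polynomials in
   s variables are algebraically dependent, while s + 1 polynomials in s + 1
   variables with invertible Jacobian are not.

   Upper bound for the Grassmannian: in a chain of irreducible closed sets of
   length d, polynomials f_i vanishing on the ith set but not on the next one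
   are algebraically independent, so that d is at most the number of parameters
   of an affine chart. *)

Set Implicit Arguments.
Unset Strict Implicit.
Unset Printing Implicit Defensive.

Import Order.TTheory GRing.Theory Num.Theory.

Local Open Scope ring_scope.

(** * Algebraic dependence of polynomials *)

Lemma poly_neq0_nonroot (K : numDomainType) (p : {poly K}) :
  p != 0 -> exists x, p.[x] != 0.
Proof.
move=> p0; pose s := [seq i%:R : K | i <- iota 0 (size p)].
have us : uniq s.
  by rewrite map_inj_uniq ?iota_uniq // => i j /eqP; rewrite eqr_nat => /eqP.
case: (boolP (all (root p) s)) => [/max_poly_roots/(_ us)|/allPn[x _ rx]].
  by move=> /(_ p0); rewrite size_map size_iota ltnn.
by exists x.
Qed.

Section MPoly.
Variable K : numFieldType.

(** Induction on [n]: some coefficient with respect to the last variable is a nonzero polynomial in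
    the others. Fixing these at a point where it does not vanish leaves a nonzero polynomial in one
    variable. *)
Lemma mpoly_neq0_nonroot n (p : mpoly n K) :
  p != 0 -> exists v, meval v p != 0.
Proof.
elim: n p => [|n IHn] p p0.
  exists (fun=> 0); rewrite [p]nvar0_mpolyC mevalC.
  by apply: contraNneq p0 => c0; rewrite [p]nvar0_mpolyC c0 mpolyC0.
case supp: (msupp p) => [|m0 s].
  by move/msuppnil0: supp p0 => ->; rewrite eqxx.
have m0p : m0 \in msupp p by rewrite supp inE eqxx.
pose rst (m : multinom n.+1) : multinom n := Multinom [tuple m (lift ord_max i) | i < n].
(* The coefficient in [p] of the power of the last variable occurring in [m0]. *)
pose c : mpoly n K :=
  \sum_(m <- msupp p | m ord_max == m0 ord_max) mcoeff m p *: mpolyX K (rst m).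
have rstP (m : multinom n.+1) : m ord_max = m0 ord_max -> rst m = rst m0 -> m = m0.
  move=> em er; apply/mnmP => i; case: (unliftP ord_max i) => [j ->|-> //].
  by move/mnmP: er => /(_ j); rewrite !mnmE.
have c0 : c != 0.
  apply: contraTneq (m0p) => /(congr1 (mcoeff (rst m0))).
  rewrite mcoeff0 raddf_sum /= big_mkcond (bigD1_seq m0 m0p (msupp_uniq p)) /=.
  rewrite eqxx mcoeffZ mcoeffX eqxx mulr1 big1_seq ?addr0.
    by move=> e; rewrite mcoeff_msupp e eqxx.
  move=> m /andP[mm0 _]; case: eqP => // em; rewrite mcoeffZ mcoeffX.
  by case: eqP => [/(rstP _ em)/eqP|_]; rewrite ?(negPf mm0) ?mulr0.
have [v cv] := IHn _ c0.
pose q : {poly K} := \sum_(m <- msupp p)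
   (mcoeff m p * \prod_i v i ^+ rst m i) *: 'X^(m ord_max).
have q0 : q != 0.
  apply: contraNneq cv => /(congr1 (fun r : {poly K} => r`_(m0 ord_max))).
  rewrite coef0 coef_sum => e; apply/eqP; rewrite -[RHS]e /c raddf_sum /= big_mkcond /=.
  apply/eq_bigr => m _; rewrite coefZ coefXn eq_sym.
  by case: eqP => _; rewrite ?mulr0 // mulr1 mevalZ mevalX.
have [x qx] := poly_neq0_nonroot q0.
exists (fun i => if unlift ord_max i is Some j then v j else x).
apply: contraNneq qx => <-; rewrite horner_sum mevalE; apply/eqP/eq_bigr => m _.
rewrite hornerZ hornerXn -mulrA; congr (_ * _).
rewrite [RHS](bigD1 ord_max) //= unlift_none mulrC; congr (_ * _).
rewrite (reindex_omap (lift ord_max) (unlift ord_max)) /=; last first.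
  by move=> i ni; case: unliftP ni => [j ->|->] //; rewrite eqxx.
apply: eq_big => [i|i _]; last by rewrite liftK mnmE.
by rewrite liftK eqxx eq_sym neq_lift.
Qed.

Lemma mpoly_alg_ind n (Q : mpoly n K -> Prop) :
  (forall c, Q (mpolyC n c)) -> (forall i, Q (mpolyX K (mnm1 i))) ->
  (forall p q, Q p -> Q q -> Q (p + q)) ->
  (forall p q, Q p -> Q q -> Q (p * q)) -> forall p, Q p.
Proof.
move=> QC QX QD QM; elim/mpolyind => [|c m p _ _ Qp].
  by rewrite -mpolyC0; apply: QC.
apply: QD => //; rewrite -mul_mpolyC; apply: (QM) (QC c) _; rewrite mpolyXE_id.
elim/big_ind: _ => // [|i _]; first exact: (QC 1).
by elim: (m i) => [|k IHk]; rewrite ?expr0 ?exprS; [exact: (QC 1)|exact: QM].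
Qed.

Definition msubst n k (h : 'I_n -> mpoly k K) (p : mpoly n K) : mpoly k K :=
  mmap (@mpolyC k K) h p.

Lemma meval_msubst n k (h : 'I_n -> mpoly k K) p v :
  meval v (msubst h p) = meval (fun i => meval v (h i)) p.
Proof.
elim/mpoly_alg_ind: p => [c|i|p q|p q]; rewrite /msubst.
- by rewrite mmapC !mevalC.
- by rewrite mmapX mmap1U mevalXU.
- by move=> Hp Hq; rewrite !mmapD !mevalD Hp Hq.
by move=> Hp Hq; rewrite rmorphM !mevalM Hp Hq.
Qed.

(** The chain rule: it turns a relation between polynomials into a linear relation between the rows
    of their Jacobian matrix. *)
Lemma mderiv_msubst n k (h : 'I_n -> mpoly k K) p j :
  mderiv j (msubst h p) = \sum_i msubst h (mderiv i p) * mderiv j (h i).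
Proof.
elim/mpoly_alg_ind: p => [c|i|p q|p q]; rewrite /msubst.
- by rewrite mmapC mderivC big1 // => i _; rewrite mderivC mmap0 mul0r.
- rewrite mmapX mmap1U (bigD1 i) //= mderivX mnm1E eqxx scale1r.
  rewrite (_ : mnm_sub _ _ = @mnm0 n).
    rewrite mpolyX0 rmorph1 mul1r big1 ?addr0 // => l li.
    by rewrite mderivX mnm1E eq_sym (negPf li) scale0r mmap0 mul0r.
  by apply/mnmP => l; rewrite mnmBE subnn mnm0E.
- move=> Hp Hq; rewrite mmapD mderivD Hp Hq -big_split /=.
  by apply: eq_bigr => i _; rewrite mderivD mmapD mulrDl.
move=> Hp Hq; rewrite rmorphM /= mderivM Hp Hq mulr_suml mulr_sumr -big_split /=.
by apply: eq_bigr => i _; rewrite mderivM rmorphD !rmorphM /=; ring.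
Qed.

End MPoly.

Section Independence.
Variable K : numFieldType.

(* For M large the monomials in the q i with exponents at most M outnumber the
   monomials in n variables of which they are combinations. *)
Lemma mpoly_dependent n s (q : 'I_s -> mpoly n K) : (n < s)%N ->
  exists2 P : mpoly s K, P != 0 &
    forall v, meval (fun i => meval v (q i)) P = 0.
Proof.
move=> lt_ns.
(* [e] bounds the degrees of the [q i], and [T] those of the products considered. [M] is chosen so
   that [(T + 1) ^ n <= ((s * e + 1) * (M + 1)) ^ n < (M + 1) ^ (n + 1)], which is at most
   [(M + 1) ^ s]. *)
pose e := (\max_i msize (q i))%N.
pose M := ((s * e).+1 ^ n)%N; pose T := (s * (M * e))%N.
pose mn k b (a : {ffun 'I_k -> 'I_b.+1}) : multinom k :=
  Multinom [tuple (a i : nat) | i < k].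
have mnE k b (a : {ffun 'I_k -> 'I_b.+1}) i : mn _ _ a i = a i by rewrite mnmE.
have mn_inj k b : injective (@mn k b).
  by move=> a a' /mnmP eaa'; apply/ffunP => i; apply/val_inj; move: (eaa' i); rewrite !mnE.
pose g (a : {ffun 'I_s -> 'I_M.+1}) := msubst q (mpolyX K (mn _ _ a)).
have degX (p : mpoly n K) d k m :
  (forall m, m \in msupp p -> mdeg m <= d)%N -> m \in msupp (p ^+ k) -> (mdeg m <= k * d)%N.
  move=> pd; elim: k m => [|k IHk] m.
    by rewrite expr0 msupp1 inE => /eqP->; rewrite mdeg0.
  rewrite exprS => /msuppM_le /allpairsP[[m1 m2] /= [m1p m2p ->]].
  by rewrite mdegD mulSn leq_add ?pd ?IHk.
have degg a m : m \in msupp (g a) -> (mdeg m <= T)%N.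
  rewrite /g /msubst mmapX /mmap1 /T -[s in (s * _)%N]card_ord -sum_nat_const.
  elim/big_ind2: _ m => [m|p1 d1 p2 d2 H1 H2 m|i _ m].
  - by rewrite msupp1 inE => /eqP->; rewrite mdeg0.
  - move=> /msuppM_le /allpairsP[[m1 m2] /= [m1p m2p ->]].
    by rewrite mdegD leq_add ?H1 ?H2.
  move=> /degX-/(_ e) H; apply: leq_trans (H _) _ => [m' mq|].
    apply: leq_trans (leq_bigmax i); exact: ltnW (msize_mdeg_lt mq).
  by rewrite leq_mul2r mnE -ltnS ltn_ord orbT.
(* Rows are the products of powers of the [q i], columns the monomials of their expansions; a vector
   in the left kernel is the coefficient vector of a relation. *)
pose A := \matrix_(a < #|{ffun 'I_s -> 'I_M.+1}|, b < #|{ffun 'I_n -> 'I_T.+1}|)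
   mcoeff (mn _ _ (enum_val b)) (g (enum_val a)).
have [u u0 uA] : exists2 u : 'rV_#|{ffun 'I_s -> 'I_M.+1}|, u != 0 & u *m A = 0.
  have : ~~ row_free A.
    rewrite /row_free neq_ltn (leq_ltn_trans (rank_leq_col A)) //.
    rewrite !card_ffun !card_ord.
    apply: leq_trans (_ : M.+1 ^ n.+1 <= _)%N; last first.
      by rewrite leq_exp2l // ltnS expn_gt0.
    apply: leq_ltn_trans (_ : ((s * e).+1 * M.+1) ^ n < _)%N.
      have le_exp a b : (a <= b -> a ^ n <= b ^ n)%N.
        by case: (n) => [|l] le_ab; rewrite ?expn0 // leq_exp2r.
      by apply: le_exp; rewrite /T mulnCA mulSn mulnS; lia.
    by rewrite expnMn expnS ltn_mul2r expn_gt0 /= ltnSn.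
  rewrite -kermx_eq0 => /rowV0Pn[u /sub_kermxP uA u0].
  by exists u.
pose P := \sum_a u 0 a *: mpolyX K (mn _ _ (enum_val a)).
exists P.
  apply: contra_neq u0 => P0; apply/rowP => a; rewrite mxE.
  move/(congr1 (mcoeff (mn _ _ (enum_val a)))): P0.
  rewrite mcoeff0 raddf_sum (bigD1 a) //= mcoeffZ mcoeffX eqxx mulr1.
  rewrite big1 ?addr0 // => b ba; rewrite mcoeffZ mcoeffX.
  by case: eqP => [/mn_inj/enum_val_inj/eqP|]; rewrite ?(negPf ba) ?mulr0.
suff gP : msubst q P = 0 by move=> v; rewrite -meval_msubst gP meval0.
have -> : msubst q P = \sum_a u 0 a *: g (enum_val a).
  rewrite /P /msubst raddf_sum; apply: eq_bigr => a _.
  by rewrite /= mmapZ mul_mpolyC.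
apply/mpolyP => m; rewrite mcoeff0 raddf_sum /=.
case: (leqP (mdeg m) T) => mT; last first.
  apply: big1 => a _; rewrite mcoeffZ memN_msupp_eq0 ?mulr0 //.
  by apply: contraTN mT => /degg; rewrite -leqNgt.
have mb i : (m i < T.+1)%N.
  by rewrite ltnS; apply: leq_trans mT; rewrite mdegE (bigD1 i) //= leq_addr.
pose b : {ffun 'I_n -> 'I_T.+1} := [ffun i => Ordinal (mb i)].
have -> : m = mn _ _ b by apply/mnmP => i; rewrite mnE ffunE.
move/rowP: uA => /(_ (enum_rank b)); rewrite !mxE => uA; rewrite -[RHS]uA.
by apply: eq_bigr => a _; rewrite mcoeffZ mxE enum_rankK.
Qed.

Lemma mderiv_eq0 n (p : mpoly n K) : (forall i, mderiv i p = 0) ->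
  p = mpolyC n (mcoeff (@mnm0 n) p).
Proof.
move=> dp; apply/mpolyP => m; rewrite mcoeffC.
case: (eqVneq m (@mnm0 n)) => [->|m0]; first by rewrite mulr1.
have [i mi] : exists i, m i != 0%N.
  apply/existsP; apply: contraNT m0; rewrite negb_exists => /forallP m0.
  by apply/eqP/mnmP => i; rewrite mnm0E; apply/eqP; rewrite -[_ == _]negbK.
rewrite mulr0; move/(congr1 (mcoeff (mnm_sub m (mnm1 i)))): (dp i).
rewrite mcoeff0 mcoeff_mderiv submK; last by rewrite lep1mP.
by move/eqP; rewrite mulrn_eq0 /= => /eqP.
Qed.

Lemma msize_mderiv n i (p : mpoly n K) : mderiv i p != 0 ->
  (msize (mderiv i p) < msize p)%N.
Proof.
move=> dp0; rewrite -(mlead_deg dp0).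
have : mlead (mderiv i p) \in msupp (mderiv i p) by apply: mlead_supp.
rewrite mcoeff_msupp mcoeff_mderiv mulrn_eq0 /= -mcoeff_msupp.
by move/msize_mdeg_lt; rewrite mdegD mdeg1 addn1.
Qed.

(** Induction on the size of [P]. If [msubst g P = 0], the chain rule puts the substituted partial
    derivatives of [P] in the left kernel of the Jacobian, whose determinant is nonzero at [x]. So
    they are relations of smaller size, hence the derivatives are zero and [P] is constant. *)
Lemma jacobian_independent s (g : 'I_s -> mpoly s K) (x : 'I_s -> K)
    (P : mpoly s K) :
  \matrix_(i, j) meval x (mderiv j (g i)) \in unitmx -> P != 0 ->
  msubst g P != 0.
Proof.
move=> Jx; have [k] := ubnP (msize P); elim: k P => // k IHk P szP P0.
apply: contra_neq P0 => gP.
have dP i : mderiv i P = 0.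
  apply/eqP; apply: contraT => dP0.
  have : msubst g (mderiv i P) != 0.
    by apply: IHk => //; apply: leq_trans (msize_mderiv dP0) _.
  case/negP; pose J : 'M_s := \matrix_(i, j) mderiv j (g i).
  pose w := \row_i msubst g (mderiv i P).
  have wJ : w *m J = 0.
    apply/rowP => j; rewrite !mxE; transitivity (mderiv j (msubst g P)).
      by rewrite mderiv_msubst; apply: eq_bigr => l _; rewrite !mxE.
    by rewrite gP mderiv0.
  have detJ : \det J != 0.
    apply: contraTneq Jx => detJ.
    rewrite unitmxE (_ : \matrix_(i, j) _ = map_mx (meval x) J).
      by rewrite det_map_mx detJ rmorph0 unitr0.
    by apply/matrixP => a b; rewrite !mxE.
  (* The entries of [J] are polynomials, so [J] is cancelled through its adjugate. *)
  have := congr1 (mulmx^~ (\adj J)) wJ; rewrite /= mul0mx -mulmxA mul_mx_adj.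
  rewrite mul_mx_scalar => /rowP/(_ i); rewrite !mxE => /eqP.
  by rewrite mulf_eq0 (negPf detJ).
by move: gP; rewrite (mderiv_eq0 dP) /msubst mmapC.
Qed.

End Independence.

(** * Homogeneous relations, and independence along chains *)

Section Homogeneous.
Variable K : numFieldType.

Lemma meval_homog n d (p : mpoly n K) (c : K) v : p \is ishomog1 d mdeg ->
  meval (fun i => c * v i) p = c ^+ d * meval v p.
Proof.
move=> /dhomogP hp; rewrite !mevalE mulr_sumr; apply: eq_big_seq => m /hp /= <-.
rewrite mulrCA; congr (_ * _); rewrite mdegE -prodrXr -big_split /=.
by apply: eq_bigr => i _; rewrite exprMn.
Qed.

(** At [x * v] a relation becomes a polynomial in [x] whose coefficients are the values at [v] of
    its homogeneous components. It vanishes identically, so each component is itself a relation. *)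
Lemma homog_dependent n s e (g : 'I_s -> mpoly n K) : (n < s)%N -> (0 < e)%N ->
  (forall i c v, meval (fun j => c * v j) (g i) = c ^+ e * meval v (g i)) ->
  exists d, exists2 P : mpoly s K, P \is ishomog1 d mdeg /\ P != 0 &
    forall v, meval (fun i => meval v (g i)) P = 0.
Proof.
move=> lt_ns e0 hg; have [P P0 gP] := mpoly_dependent g lt_ns.
have [d dP] : exists d, pihomog mdeg d P != 0.
  apply: contrapT => /forallNP Pd; case/negP: P0; apply/eqP.
  rewrite (pihomog_partitionE (leqnn (msize P))) big1 // => i _.
  by apply/eqP/negPn/negP/Pd.
exists d, (pihomog mdeg d P); first by rewrite pihomogP.
move=> v; pose c k := meval (fun i => meval v (g i)) (pihomog mdeg k P).
pose q : {poly K} := \sum_(k < msize P) c k *: 'X^(k * e).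
have q0 : q = 0.
  apply/eqP; apply: contraT => /poly_neq0_nonroot[x /negP[]]; apply/eqP.
  rewrite -[RHS](gP (fun j => x * v j)).
  rewrite [in RHS](pihomog_partitionE (leqnn (msize P))) raddf_sum horner_sum.
  apply: eq_bigr => k _; rewrite hornerZ hornerXn mulrC exprM exprAC.
  by rewrite -(meval_homog _ _ (pihomogP _ _ _)); apply: meval_eq => i; rewrite hg.
move/(congr1 (fun r : {poly K} => r`_(d * e))): q0; rewrite coef0 coef_sum.
case: (ltnP d (msize P)) => dP'.
  rewrite (bigD1 (Ordinal dP')) //= coefZ coefXn eqxx mulr1 big1 ?addr0 //.
  move=> k kd; rewrite coefZ coefXn eqn_pmul2r //.
  by case: eqP => [dk|]; rewrite ?mulr0 //; case/eqP: kd; apply: val_inj.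
case/negP: dP; rewrite pihomogE big_seq_cond big1 // => m /andP[/msize_mdeg_lt mP /eqP md].
by move: (leq_trans mP dP'); rewrite -md ltnn.
Qed.

(** Powers of a variable of [p] itself, rather than of a new one, raise every component to degree
    [msize p]; values are unchanged where this variable is 1. *)
Definition homogenize n (i : 'I_n) (p : mpoly n K) : mpoly n K :=
  \sum_(d < msize p) mpolyX K (mnm1 i) ^+ (msize p - d) * pihomog mdeg d p.

Lemma homogenize_homog n (i : 'I_n) p : homogenize i p \is ishomog1 (msize p) mdeg.
Proof.
apply: rpred_sum => d _; rewrite -{4}(subnK (ltnW (ltn_ord d))).
apply: dhomogM; last exact: pihomogP.
have hX : mpolyX K (mnm1 i) \is ishomog1 1 mdeg by rewrite dhomogX /= mdeg1.
by have := dhomogMn (msize p - d) hX; rewrite mul1n.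
Qed.

Lemma meval_homogenize n (i : 'I_n) p v : v i = 1 ->
  meval v (homogenize i p) = meval v p.
Proof.
move=> vi; rewrite [in RHS](pihomog_partitionE (leqnn (msize p))) !raddf_sum /=.
by apply: eq_bigr => d _; rewrite mevalM rmorphXn /= mevalXU vi expr1n mul1r.
Qed.

(* If each f i vanishes on U i but not on U i.+1, divide a relation between
   f 0, ..., f j on U j.+1 by the power of f j in it and restrict it to U j. *)
Lemma chain_independent (V : Type) s (U : nat -> V -> Prop) (f : 'I_s -> V -> K) :
  (exists v, U 0%N v) ->
  (forall (i : 'I_s) v, U i v -> U i.+1 v) ->
  (forall (i : 'I_s) v, U i v -> f i v = 0) ->
  (forall i : 'I_s, exists2 v, U i.+1 v & f i v != 0) ->
  (forall j (P Q : mpoly s K), (j <= s)%N ->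
     (forall v, U j v -> meval (f^~ v) P * meval (f^~ v) Q = 0) ->
     (forall v, U j v -> meval (f^~ v) P = 0) \/
     (forall v, U j v -> meval (f^~ v) Q = 0)) ->
  forall P, P != 0 -> exists2 v, U s v & meval (f^~ v) P != 0.
Proof.
move=> U0 US f0 fS Uprime.
(* The induction on [j] concerns the polynomials in the first [j] variables only, and their values
   on [U j]. *)
suff H j : (j <= s)%N -> forall P : mpoly s K, P != 0 ->
    (forall m, m \in msupp P -> forall i : 'I_s, (j <= i)%N -> m i = 0%N) ->
    exists2 v, U j v & meval (f^~ v) P != 0.
  move=> P P0; apply: H => // m _ i; by rewrite leqNgt ltn_ord.
elim: j => [_ P P0 Pj|j IHj lt_js P].
  have [v Uv] := U0; exists v => //.
  have PC : P = mpolyC s (mcoeff (@mnm0 s) P).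
    apply/mpolyP => m; rewrite mcoeffC; case: (boolP (m \in msupp P)) => mP.
      have -> : m = @mnm0 s by apply/mnmP => i; rewrite mnm0E (Pj m mP).
      by rewrite eqxx mulr1.
    rewrite (memN_msupp_eq0 mP); case: eqP => em; rewrite ?mulr0 //.
    by rewrite mulr1 -em memN_msupp_eq0.
  by rewrite PC mevalC; apply: contraNneq P0; rewrite {2}PC => ->; rewrite mpolyC0.
pose i := Ordinal lt_js.
have [k] := ubnP (msize P); elim: k P => // k IHk P szP P0 Pj.
case: (boolP (has (fun m : multinom s => m i == 0%N) (msupp P))) => [|/hasPn Pi].
  move=> /hasP[m0 m0P /eqP m0i].
  (* On [U j] the function [f i] vanishes, so [P] agrees there with its part [P0'] free of the
     variable [i]. *)
  pose P0' := \sum_(m <- msupp P | m i == 0%N) mcoeff m P *: mpolyX K m.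
  have cP0 m : mcoeff m P0' = if m i == 0%N then mcoeff m P else 0.
    rewrite raddf_sum /= big_mkcond /=.
    case: (boolP (m \in msupp P)) => mP; last first.
      rewrite (memN_msupp_eq0 mP) if_same big1_seq // => m' /andP[_ m'P].
      case: ifP => // _; rewrite mcoeffZ mcoeffX.
      by case: eqP => [em|]; rewrite ?mulr0 //; move: mP; rewrite -em m'P.
    rewrite (bigD1_seq m mP (msupp_uniq P)) /= mcoeffZ mcoeffX eqxx mulr1.
    rewrite big1 ?addr0 // => m' m'm; case: ifP => // _.
    by rewrite mcoeffZ mcoeffX (negPf m'm) mulr0.
  have [||v Uv Pv] := IHj (ltnW lt_js) P0'.
  - apply: contraTneq m0P => /(congr1 (mcoeff m0)).
    by rewrite cP0 m0i eqxx mcoeff0 mcoeff_msupp => ->; rewrite eqxx.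
  - move=> m; rewrite mcoeff_msupp cP0; case: ifP => [mi|]; last by rewrite eqxx.
    rewrite -mcoeff_msupp => mP l; rewrite leq_eqVlt => /predU1P[jl|]; last exact: Pj.
    by rewrite -(eqP mi); congr (m _); apply: val_inj.
  exists v; first exact: (US i).
  apply: contraNneq Pv => Pv; apply/eqP; rewrite -[RHS]Pv [RHS]mevalE.
  rewrite [RHS](bigID (fun m : multinom s => m i == 0%N)) /= [X in _ + X]big1 ?addr0.
    rewrite raddf_sum /=; apply: eq_bigr => m _.
    by rewrite mevalZ mevalX.
  move=> m mi; rewrite (bigD1 i) //= f0 //.
  by rewrite expr0n (negPf mi) mul0r mulr0.
(* Here the variable [i] divides [P]. As [f i] does not vanish on [U j.+1], primality passes a
   relation [P] on to the smaller quotient [Q]. *)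
pose Q := \sum_(m <- msupp P) mcoeff m P *: mpolyX K (mnm_sub m (mnm1 i)).
have PQ : P = Q * mpolyX K (mnm1 i).
  rewrite {1}[P]mpolyE mulr_suml; apply: eq_big_seq => m mP.
  by rewrite -scalerAl -mpolyXD submK // lep1mP; apply: Pi.
have Q0 : Q != 0 by apply: contra_neq P0; rewrite PQ => ->; rewrite mul0r.
have X0 : mpolyX K (mnm1 i) != 0 by rewrite -msize_poly_eq0 msizeX.
have [||v Uv Qv] := IHk Q _ Q0.
- by move: szP; rewrite PQ msizeM // msizeX mdeg1 addn2 /= ltnS.
- move=> m mQ l jl; have := Pj (mnm_add (mnm1 i) m).
  rewrite mcoeff_msupp {1}PQ mcoeffMX -mcoeff_msupp => /(_ mQ l jl) /eqP.
  by rewrite mnmDE addn_eq0 => /andP[_ /eqP].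
have [w Uw fw] := fS i.
apply: contrapT => /forall2NP PU.
have [|Qz|Xz] := Uprime j.+1 Q (mpolyX K (mnm1 i)) lt_js.
- move=> u Uu; rewrite -mevalM -PQ; have [//|] := PU u.
  by move/negP/negPn/eqP.
- by rewrite Qz ?eqxx in Qv.
by move: fw; rewrite -[f i w](mevalXU (f^~ w)) Xz ?eqxx.
Qed.

End Homogeneous.

(** * Dimension of projective sets *)

Section Projective.
Variables (R : realType) (N : nat).
Local Notation C := (R[i]).
Local Notation proj := (proj R N).
Implicit Types (f g : mpoly N.+1 C) (p : proj) (v : 'rV[C]_N.+1).

Lemma proj_span p : exists2 v, v != 0 & val p = <[v]>%VS.
Proof.
case: p => L /= /eqP dL; exists (vpick L).
  by rewrite vpick0 -dimv_eq0 dL.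
apply/esym/eqP; rewrite eqEdim -memvE memv_pick dL dim_vline.
by rewrite vpick0 -dimv_eq0 dL.
Qed.

Definition proj_of v (v0 : v != 0) : proj :=
  exist _ <[v]>%VS (introT eqP (etrans (dim_vline v) (congr1 nat_of_bool v0))).

Lemma span_neq0 p v : val p = <[v]>%VS -> v != 0.
Proof.
case: p => L /= /eqP dL eL; apply: contra_eq_neq dL => v0.
by rewrite eL v0 dim_vline eqxx.
Qed.

Lemma vlineZ (c : C) v : c != 0 -> <[c *: v]>%VS = <[v]>%VS.
Proof.
move=> c0; apply/eqP; rewrite eqEsubv -!memvE memvZ ?memv_line //=.
by rewrite -[X in X \in _](scalerK c0) memvZ ?memv_line.
Qed.

Lemma vanishes_span d f p v : f \is ishomog1 d mdeg -> val p = <[v]>%VS ->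
  vanishes_at f p <-> meval (v 0) f = 0.
Proof.
move=> hf pv; split=> [|fv w]; first by apply; rewrite pv memv_line.
rewrite pv => /vlineP[c ->]; have := meval_homog c (v 0) hf; rewrite fv mulr0 => <-.
by apply: meval_eq => i; rewrite mxE.
Qed.

Lemma vanishesM d e f g p : f \is ishomog1 d mdeg -> g \is ishomog1 e mdeg ->
  vanishes_at (f * g) p -> vanishes_at f p \/ vanishes_at g p.
Proof.
move=> hf hg; have [v _ pv] := proj_span p.
move=> /(vanishes_span (dhomogM hf hg) pv)/eqP; rewrite mevalM mulf_eq0.
by case/orP=> /eqP fv; [left; apply/(vanishes_span hf pv)|right; apply/(vanishes_span hg pv)].
Qed.

Definition zeros f : set proj := [set p | vanishes_at f p]%classic.

Lemma zariski_closed_zeros d f : f \is ishomog1 d mdeg -> zariski_closed (zeros f).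
Proof.
move=> hf; exists [set f]%classic => [_ ->|]; first exact: homogE hf.
by apply/seteqP; split=> p /=; [move=> fp _ ->|apply].
Qed.

Lemma irreducible_vanishes (X : set proj) d e f g : irreducible X ->
  f \is ishomog1 d mdeg -> g \is ishomog1 e mdeg ->
  (forall p, X p -> vanishes_at f p \/ vanishes_at g p) ->
  (forall p, X p -> vanishes_at f p) \/ (forall p, X p -> vanishes_at g p).
Proof.
by move=> [_ Xirr] hf hg fg;
  apply: (Xirr _ _ (zariski_closed_zeros hf) (zariski_closed_zeros hg)).
Qed.

Lemma closed_in_separated (X F : set proj) p : closed_in X F -> X p -> ~ F p ->
  exists d, exists2 f, f \is ishomog1 d mdeg &
    (forall q, F q -> vanishes_at f q) /\ ~ vanishes_at f p.
Proof.
move=> [_ [E Eh ->] ->] Xp; rewrite not_andP => -[//|/existsNP[f /not_implyP[Ef fp]]].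
have /homogP[d hf] := Eh f Ef; exists d, f => //; split=> // q [_]; exact.
Qed.

(** Take the chart through a point of the smallest set of a chain of length [d]. Forms separating
    consecutive sets are independent on the largest set, whereas in the chart they are polynomials
    in [D] parameters; so [d <= D]. *)
Lemma dimension_le (X : set proj) (D : nat) :
  (forall p v, X p -> val p = <[v]>%VS -> exists2 k, v 0 k != 0 &
     exists phi : 'I_N.+1 -> mpoly D C,
     forall q w, X q -> val q = <[w]>%VS -> w 0 k = 1 ->
       exists y, forall i, w 0 i = meval y (phi i)) ->
  (dimension X <= D%:R%:E)%E.
Proof.
move=> chart; apply: ge_ereal_sup => _ [d [F [Firr Flt]] <-].
rewrite lee_fin ler_nat leqNgt; apply/negP => lt_Dd.
have FX i q : (i <= d)%N -> F i q -> X q by move=> /Firr[[Z _ ->] _] [].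
have Fle i j q : (i <= j <= d)%N -> F i q -> F j q.
  move=> /andP[/subnK <-]; elim: (j - i)%N => // l IHl ld Fiq.
  by have [+ _] := Flt _ ld; apply; apply: IHl => //; apply: ltnW.
have [p0 Fp0] : (F 0%N !=set0)%classic by have [_ []] := Firr 0%N isT.
have [v0 v00 pv0] := proj_span p0.
have [k v0k [phi phiP]] := chart _ _ (FX 0%N _ isT Fp0) pv0.
pose Xk := mpolyX C (mnm1 k).
have Xkh : Xk \is ishomog1 1 mdeg by rewrite dhomogX /= mdeg1.
(* [F i] contains [p0], which is off the hyperplane [Xk = 0], so irreducibility allows [Xk] to be
   cancelled. *)
have irrX i e f : (i <= d)%N -> f \is ishomog1 e mdeg ->
    (forall q, F i q -> vanishes_at (f * Xk) q) -> forall q, F i q -> vanishes_at f q.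
  move=> id hf fX; have [_ Fi] := Firr i id.
  have [|//|Xv] := irreducible_vanishes Fi hf Xkh.
    by move=> q /fX; apply: vanishesM hf Xkh.
  have /(vanishes_span Xkh pv0)/eqP := Xv p0 (Fle 0%N i p0 id Fp0).
  by rewrite mevalXU (negPf v0k).
(* Representatives normalized by the [k]th coordinate: the trace of [F i] on the affine chart. *)
pose U i v := v 0 k = 1 /\ exists2 p, F i p & val p = <[v]>%VS.
have UF i e f : (i <= d)%N -> f \is ishomog1 e mdeg ->
    (forall v, U i v -> meval (v 0) f = 0) -> forall q, F i q -> vanishes_at f q.
  move=> id hf fU; apply: (irrX _ e) => // q Fq; have [w _ qw] := proj_span q.
  apply/(vanishes_span (dhomogM hf Xkh) qw); rewrite mevalM mevalXU.
  have [->|wk] := eqVneq (w 0 k) 0; first by rewrite mulr0.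
  suff fw : meval (w 0) f = 0 by rewrite fw mul0r.
  pose c := (w 0 k)^-1.
  have qw' : val q = <[c *: w]>%VS by rewrite qw vlineZ ?invr_eq0.
  apply/(vanishes_span hf qw); apply/(vanishes_span hf qw'); apply: fU; split.
    by rewrite mxE mulVf.
  by exists q.
have sep (i : 'I_d) : exists f, (forall v, U i v -> meval (v 0) f = 0) /\
    exists2 v, U i.+1 v & meval (v 0) f != 0.
  have id := ltn_ord i; have [_ /existsNP[q /not_implyP[Fq nFq]]] := Flt i id.
  have [Fc _] := Firr i (ltnW id).
  have [e [f hf [fF fq]]] := closed_in_separated Fc (FX _ q id Fq) nFq.
  exists f; split=> [v [_ [p /fF + pv]]|]; first by move/(vanishes_span hf pv).
  apply: contrapT => /forall2NP fU; apply: fq; apply: (UF i.+1 e) => // v Uv.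
  by have [//|/negP/negPn/eqP] := fU v.
have [f /all_and2[fU fU']] := choice sep.
have [P P0 Pphi] := mpoly_dependent (fun i => msubst phi (f i)) lt_Dd.
have [|||||v [vk [q Fq qv]]] := @chain_independent _ _ _ U (fun i v => meval (v 0) (f i))
    _ _ _ _ _ P P0.
- exists ((v0 0 k)^-1 *: v0); split; first by rewrite mxE mulVf.
  by exists p0 => //; rewrite pv0 vlineZ ?invr_eq0.
- move=> i v [vk [p Fp pv]]; split=> //; exists p => //.
  by have [+ _] := Flt i (ltn_ord i); apply.
- by move=> i v; apply: fU.
- exact: fU'.
- move=> j P1 P2 jd PP.
  (* Homogenizing by [Xk] keeps the values on [U j], so the primality required there follows from
     the irreducibility of [F j]. *)
  have homog P' : exists e, exists2 h, h \is ishomog1 e mdeg &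
      forall v, U j v -> meval (v 0) h = meval (fun i => meval (v 0) (f i)) P'.
    exists (msize (msubst f P')), (homogenize k (msubst f P')).
      exact: homogenize_homog.
    by move=> v [vk _]; rewrite meval_homogenize // meval_msubst.
  have [[e1 [h1 hh1 hE1]] [e2 [h2 hh2 hE2]]] := (homog P1, homog P2).
  have hU e h P' : h \is ishomog1 e mdeg ->
      (forall v, U j v -> meval (v 0) h = meval (fun i => meval (v 0) (f i)) P') ->
      (forall q, F j q -> vanishes_at h q) ->
      forall v, U j v -> meval (fun i => meval (v 0) (f i)) P' = 0.
    move=> hh hE hF v Uv; rewrite -hE //; have [_ [p Fp pv]] := Uv.
    by apply/(vanishes_span hh pv); apply: hF.
  have [_ Fj] := Firr j jd.
  have [q Fq|/(hU _ _ _ hh1 hE1)|/(hU _ _ _ hh2 hE2)] :=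
    irreducible_vanishes Fj hh1 hh2; [|by left|by right].
  apply: (vanishesM hh1 hh2); apply: (UF j _ _ jd (dhomogM hh1 hh2) _ q Fq).
  by move=> v Uv; rewrite mevalM hE1 // hE2 // PP.
move=> /negP[]; apply/eqP; have [y wy] := phiP q v (FX _ _ (leqnn d) Fq) qv vk.
rewrite -[RHS](Pphi y); apply: meval_eq => i; rewrite meval_msubst.
by apply: meval_eq => l; rewrite wy.
Qed.

End Projective.

Lemma msubst_homog (K : numFieldType) n k d (h : 'I_n -> mpoly k K) (p : mpoly n K) :
  (forall i, h i \is ishomog1 1 mdeg) -> p \is ishomog1 d mdeg ->
  msubst h p \is ishomog1 d mdeg.
Proof.
move=> hh /dhomogP hp; rewrite /msubst /mmap big_seq; apply: rpred_sum => m mp.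
rewrite mul_mpolyC; apply: rpredZ; rewrite -(hp m mp) /= mdegE /mmap1.
elim/big_ind2: _ => [|p1 d1 p2 d2|i _]; first exact: dhomog1.
  exact: dhomogM.
by have := dhomogMn (m i) (hh i); rewrite mul1n.
Qed.

(** A nonzero row is a scalar times the first row of its [row_ebase], so it is enough to rescale
    that invertible matrix. *)
Lemma complete_unitmx (K : fieldType) m (x : 'rV[K]_m.+1) : x != 0 ->
  exists2 Q : 'M_m.+1, Q \in unitmx & row 0 Q = x.
Proof.
move=> x0; have rx : \rank x = 1%N by apply/eqP; rewrite rank_rV x0.
pose c := col_ebase x 0 0.
have c0 : c != 0.
  by have := col_ebase_unit x; rewrite unitmxE det_mx11 unitfE.
exists (c *: row_ebase x); first by rewrite unitmxZ ?row_ebase_unit ?unitfE.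
rewrite -[RHS]mulmx_ebase rx; apply/rowP => j; rewrite !mxE (bigD1 0) //= big1 => [|l l0].
  by rewrite addr0 !mxE big_ord1 !mxE eqxx mulr1.
rewrite !mxE big_ord1 !mxE (_ : (_ == l :> nat) = false) ?mulr0 ?mul0r //.
by apply: contraNF l0 => /eqP l0; apply/eqP/val_inj.
Qed.

(** * Lower bound for the dimension of the image of a homogeneous map *)

Section LowerBound.
Variables (R : realType) (N : nat).
Local Notation C := (R[i]).
Local Notation proj := (proj R N).

Section Flag.
Variables (m e : nat) (psi : 'I_N.+1 -> mpoly m.+1 C).
Hypothesis e_gt0 : (0 < e)%N.
Hypothesis psi_homog : forall k c v,
  meval (fun j => c * v j) (psi k) = c ^+ e * meval v (psi k).

(** Parameters where [psi] vanishes give no point, as [val p] is a line. *)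
Definition image_span (S : ('I_m.+1 -> C) -> Prop) : set proj :=
  [set p | exists2 y, S y & val p = <[\row_k meval y (psi k)]>%VS]%classic.

Definition coord_subspace s (y : 'I_m.+1 -> C) := forall l : 'I_m.+1, (s <= l)%N -> y l = 0.

Definition extend0 s (y : 'I_s -> C) (l : 'I_m.+1) : C :=
  if insub (l : nat) is Some l' then y l' else 0.

Definition restrict s (p : mpoly m.+1 C) : mpoly s C :=
  msubst (fun l : 'I_m.+1 =>
    if insub (l : nat) is Some l' then mpolyX C (mnm1 l') else 0) p.

Lemma meval_restrict s y (p : mpoly m.+1 C) : meval y (restrict s p) = meval (extend0 y) p.
Proof.
rewrite meval_msubst; apply: meval_eq => l; rewrite /extend0.
by case: insubP => [l' _ _|_]; rewrite ?mevalXU ?meval0.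
Qed.

Lemma extend0_subspace s y : coord_subspace s (@extend0 s y).
Proof. by move=> l sl; rewrite /extend0 insubF // ltnNge sl. Qed.

Lemma subspace_extend0 s y : (s <= m.+1)%N -> coord_subspace s y ->
  exists z : 'I_s -> C, y = extend0 z.
Proof.
move=> sm ys; exists (fun i => y (widen_ord sm i)); apply/funext => l.
rewrite /extend0; case: insubP => [l' _ e'|]; last by rewrite -leqNgt => /ys.
by congr y; apply: val_inj.
Qed.

Hypothesis e0_immersion :
  row_free (\matrix_(l, k) meval (fun i => (i == 0)%:R) (mderiv l (psi k))).

Let Cmat := sval (cid (row_freeP e0_immersion)).
Let CmatP := svalP (cid (row_freeP e0_immersion)).

(** Linear combinations of the coordinates of [psi] whose Jacobian matrix at the first basis vector
    is the identity. *)
Let g (b : 'I_m.+1) := \sum_k Cmat k b *: psi k.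

Let gE y b : meval y (g b) = \sum_k Cmat k b * meval y (psi k).
Proof. by rewrite raddf_sum; apply: eq_bigr => k _; rewrite /= mevalZ. Qed.

Let g_homog b c v : meval (fun j => c * v j) (g b) = c ^+ e * meval v (g b).
Proof.
by rewrite !gE mulr_sumr; apply: eq_bigr => k _; rewrite psi_homog mulrCA.
Qed.

Let g_deriv b l : meval (fun i => (i == 0)%:R) (mderiv l (g b)) = (l == b)%:R.
Proof.
move/matrixP: CmatP => /(_ l b); rewrite !mxE => <-.
rewrite [mderiv _ _]raddf_sum raddf_sum; apply: eq_bigr => k _.
by rewrite /= mderivZ mevalZ mxE mulrC.
Qed.

(** Restricted to the first [s] variables, the first [s] of the [g] still have the identity as
    Jacobian matrix at the first basis vector. *)
Let g_independent s (sm : (s <= m.+1)%N) (P : mpoly s C) : P != 0 ->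
  msubst (fun b => restrict s (g (widen_ord sm b))) P != 0.
Proof.
apply: (@jacobian_independent _ _ _ (fun i : 'I_s => ((i : nat) == 0%N)%:R)).
rewrite [X in X \in _](_ : _ = 1%:M) ?unitmx1 //; apply/matrixP => a b.
rewrite !mxE mderiv_msubst raddf_sum /= (bigD1 (widen_ord sm b)) //= big1 ?addr0.
  rewrite mevalM -/(restrict s _) meval_restrict insubT //= => bs.
  rewrite mderivX mnm1E /= (_ : _ == b); last by apply/eqP/val_inj.
  rewrite scale1r (_ : mnm_sub _ _ = @mnm0 s) ?mpolyX0 ?meval1 ?mulr1; last first.
    by apply/mnmP => l; rewrite mnmBE mnm0E !mnm1E (_ : Sub _ _ = b) ?subnn //; apply: val_inj.
  rewrite -[RHS](_ : (widen_ord sm b == widen_ord sm a)%:R = _); last first.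
    by rewrite eq_sym -!val_eqE.
  rewrite -g_deriv; apply: meval_eq => i; rewrite /extend0.
  case: insubP => [i' _ -> //|]; rewrite -leqNgt => si.
  by case: eqP => // i0; have := leq_trans (ltn_ord b) si; rewrite i0.
move=> l lb; rewrite mevalM; case: insubP => [l' _ l'l|_]; last by rewrite raddf0 meval0 mulr0.
rewrite mderivX mnm1E (_ : l' == b = false) ?scale0r ?meval0 ?mulr0 //.
by apply: contraNF lb => /eqP <-; apply/eqP/val_inj.
Qed.

(** [P] is multiplied by the restriction of the first of the [g], so that [psi] is nonzero as well
    at the point found. *)
Let point s (sm : (s < m.+1)%N) (P : mpoly s.+1 C) : P != 0 ->
  exists y : 'I_s.+1 -> C, exists2 p : proj,
    val p = <[\row_k meval (extend0 y) (psi k)]>%VS &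
    meval y P != 0.
Proof.
move=> P0; have X0 : mpolyX C (mnm1 (ord0 : 'I_s.+1)) != 0 by rewrite -msize_poly_eq0 msizeX.
have := g_independent sm X0; rewrite /msubst mmapX mmap1U => g0.
have /mpoly_neq0_nonroot[y] : P * restrict s.+1 (g (widen_ord sm ord0)) != 0.
  by rewrite mulf_neq0.
rewrite mevalM mulf_eq0 negb_or meval_restrict gE => /andP[Py gy].
have psi0 : \row_k meval (extend0 y) (psi k) != 0.
  apply: contra_neq gy => /rowP psi0; apply: big1 => k _.
  by have := psi0 k; rewrite !mxE => ->; rewrite mulr0.
by exists y, (proj_of psi0).
Qed.

(** The Zariski closure of the image of the coordinate subspace of dimension [s]. *)
Let Z s : set proj := [set p | forall d (f : mpoly N.+1 C), f \is ishomog1 d mdeg ->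
  (forall q, image_span (coord_subspace s) q -> vanishes_at f q) -> vanishes_at f p]%classic.

Let meval_psi d (f : mpoly N.+1 C) p y : f \is ishomog1 d mdeg ->
  val p = <[\row_k meval y (psi k)]>%VS ->
  vanishes_at f p <-> meval y (msubst psi f) = 0.
Proof.
move=> hf pv; rewrite (propext (vanishes_span hf pv)) meval_msubst.
by rewrite (@meval_eq _ _ _ (fun i => meval y (psi i))) // => i; rewrite mxE.
Qed.

(** The closures of the images of the coordinate subspaces form the chain. They are irreducible
    because forms pull back to polynomials, which have no zero divisors. They grow strictly because
    the first [i + 2] of the [g] are dependent on the subspace of dimension [i + 1] but not on the
    next one. *)
Lemma dimension_ge_e0 (X : set proj) :
  (image_span (fun=> True) `<=` X)%classic -> (m%:R%:E <= dimension X)%E.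
Proof.
move=> AX; apply: ereal_sup_ubound; exists m => //.
(* The vector subspace of dimension [i + 1] gives the set of index [i], so the chain has length
   [m]. *)
exists (fun i => X `&` Z i.+1)%classic.
have AZ s : (image_span (coord_subspace s) `<=` X `&` Z s)%classic.
  move=> p [y ys py]; split; first by apply: AX; exists y.
  by move=> d f hf; apply; exists y.
split=> [i im|i im]; split.
- exists (Z i.+1) => //; exists [set f | (exists d, f \is ishomog1 d mdeg) /\
    forall q, image_span (coord_subspace i.+1) q -> vanishes_at f q]%classic.
    by move=> f [[d hf] _]; apply: homogE hf.
  apply/seteqP; split=> p /= pZ f; first by move=> [[d hf] fA]; apply: (pZ d).
  by move=> fh f0 fA; apply: pZ; split=> //; exists f.
- have sm : (i < m.+1)%N by rewrite ltnS.
  split.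
    have [y [p py _]] := point sm (oner_neq0 _).
    by exists p; apply: AZ; exists (extend0 y) => //; apply: extend0_subspace.
  move=> Z1 Z2 [E1 E1h ->] [E2 E2h ->] XZ.
  have sub E : (forall f, E f -> f \is ishomog mdeg) ->
     (forall q f, image_span (coord_subspace i.+1) q -> E f -> vanishes_at f q) ->
     (X `&` Z i.+1 `<=` [set p | forall f, E f -> vanishes_at f p])%classic.
    move=> Eh EA p [_ pZ] f Ef; have /homogP[d hf] := Eh f Ef.
    by apply: (pZ d) => // q Aq; apply: EA.
  apply: contrapT => /not_orP[/(contra_not (sub E1 E1h)) n1 /(contra_not (sub E2 E2h)) n2].
  have bad E : (forall f, E f -> f \is ishomog mdeg) ->
     ~ (forall q f, image_span (coord_subspace i.+1) q -> E f -> vanishes_at f q) ->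
     exists d f, [/\ f \is ishomog1 d mdeg, E f & restrict i.+1 (msubst psi f) != 0].
    move=> Eh /existsNP[q /existsNP[f /not_implyP[[y ys qy] /not_implyP[Ef fq]]]].
    have /homogP[d hf] := Eh f Ef; exists d, f; split=> //.
    apply: contra_not_neq fq => f0; apply/(meval_psi hf qy).
    by have [z ->] := subspace_extend0 sm ys; rewrite -meval_restrict f0 meval0.
  have [[d1 [f1 [h1 Ef1 f10]]] [d2 [f2 [h2 Ef2 f20]]]] := (bad _ E1h n1, bad _ E2h n2).
  have [y [p py Py]] := point sm (mulf_neq0 f10 f20).
  have factors (a b : mpoly i.+1 C) : meval y (a * b) != 0 -> meval y a != 0 /\ meval y b != 0.
    by rewrite mevalM mulf_eq0 negb_or => /andP.
  have [y1 y2] := factors _ _ Py.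
  move: y1; rewrite meval_restrict => /eqP y1.
  move: y2; rewrite meval_restrict => /eqP y2.
  have Ap : (X `&` Z i.+1)%classic p.
    by apply: AZ; exists (extend0 y) => //; apply: extend0_subspace.
  case: (XZ p Ap) => pE; [apply: y1|apply: y2].
    exact: (meval_psi h1 py).1 (pE _ Ef1).
  exact: (meval_psi h2 py).1 (pE _ Ef2).
- move=> p [Xp pZ]; split=> // d f hf fA; apply: (pZ d) => // q [y ys qy].
  by apply: fA; exists y => // l il; apply: ys; apply: ltnW.
have sm : (i.+1 < m.+1)%N by rewrite ltnS.
pose q b := restrict i.+1 (g (widen_ord sm b)).
have [b c v|d [P [Ph P0] qP]] := homog_dependent (e := e) (g := q) (ltnSn _) e_gt0.
  rewrite !meval_restrict -g_homog; apply: meval_eq => l; rewrite /extend0.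
  by case: insubP => //; rewrite mulr0.
(* The linear form on the target space whose pullback by [psi] is [g] at [b]; the relation [P] thus
   becomes a form on the target. *)
pose L (b : 'I_i.+2) := \sum_k Cmat k (widen_ord sm b) *: mpolyX C (mnm1 k).
pose f := msubst L P.
have hf : f \is ishomog1 d mdeg.
  apply: msubst_homog => // b; apply: rpred_sum => k _; apply: rpredZ.
  by rewrite dhomogX /= mdeg1.
have fE y : meval y (msubst psi f) = meval (fun b => meval y (g (widen_ord sm b))) P.
  rewrite !meval_msubst; apply: meval_eq => b; rewrite gE raddf_sum.
  by apply: eq_bigr => k _; rewrite /= mevalZ mevalXU.
have [y [p py Py]] := point sm (g_independent sm P0).
move=> /(_ p) []; first by apply: AZ; exists (extend0 y) => //; apply: extend0_subspace.
move=> _ /(_ d f hf) fp; case/negP: Py; apply/eqP.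
suff /(meval_psi hf py) : vanishes_at f p.
  by rewrite fE meval_msubst => <-; apply: meval_eq => b; rewrite meval_restrict.
apply: fp => r [z zs rz]; apply/(meval_psi hf rz); rewrite fE.
have [w ->] := subspace_extend0 (ltnW sm) zs.
by rewrite -[RHS](qP w); apply: meval_eq => b; rewrite meval_restrict.
Qed.

End Flag.

(** A linear change of parameters sends the first basis vector, through which the coordinate flag
    passes, to [x]. *)
Lemma dimension_ge m e (psi : 'I_N.+1 -> mpoly m.+1 C) (x : 'I_m.+1 -> C)
    (X : set proj) :
  (0 < e)%N ->
  (forall k c v, meval (fun j => c * v j) (psi k) = c ^+ e * meval v (psi k)) ->
  (exists l, x l != 0) ->
  (forall z : 'I_m.+1 -> C,
     (forall k, \sum_l z l * meval x (mderiv l (psi k)) = 0) -> forall l, z l = 0) ->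
  (forall y p, val p = <[\row_k meval y (psi k)]>%VS -> X p) ->
  (m%:R%:E <= dimension X)%E.
Proof.
move=> e0 hpsi [l0 xl0] xinj AX.
have [|Q Qu Qx] := @complete_unitmx _ _ (\row_l x l).
  by apply: contra_neq xl0 => /rowP/(_ l0); rewrite !mxE.
pose h (a : 'I_m.+1) := \sum_l Q l a *: mpolyX C (mnm1 l).
have hE y a : meval y (h a) = \sum_l Q l a * y l.
  by rewrite raddf_sum; apply: eq_bigr => l _; rewrite /= mevalZ mevalXU.
have hD l a : mderiv l (h a) = mpolyC _ (Q l a).
  rewrite /h [mderiv _ _]raddf_sum (bigD1 l) //= mderivZ mderivX mnm1E eqxx scale1r.
  rewrite big1 ?addr0 => [|i il]; last first.
    by rewrite mderivZ mderivX mnm1E (negPf il) scale0r scaler0.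
  rewrite (_ : mnm_sub _ _ = @mnm0 _) ?mpolyX0; last first.
    by apply/mnmP => i; rewrite mnmBE mnm0E subnn.
  by rewrite -mul_mpolyC mulr1.
have he0 a : meval (fun i => (i == 0)%:R) (h a) = x a.
  move/rowP: Qx => /(_ a); rewrite !mxE => <-; rewrite hE (bigD1 0) //= big1 ?addr0 ?mulr1 //.
  by move=> l /negPf->; rewrite mulr0.
apply: (@dimension_ge_e0 m e (fun k => msubst h (psi k))) => //.
- move=> k c v; rewrite !meval_msubst -hpsi; apply: meval_eq => a; rewrite !hE mulr_sumr.
  by apply: eq_bigr => l _; rewrite mulrCA.
- pose J := \matrix_(a, k) meval x (mderiv a (psi k)).
  rewrite (_ : \matrix_(_, _) _ = Q *m J).
    rewrite /row_free mxrankMfree; first by rewrite -/(row_free Q) row_free_unit.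
    rewrite -kermx_eq0; apply: contraT => /rowV0Pn[u /sub_kermxP uJ /eqP[]].
    apply/rowP => l; rewrite mxE; apply: xinj => k.
    move/rowP: uJ => /(_ k); rewrite !mxE => uJ; rewrite -[RHS]uJ.
    by apply: eq_bigr => a _; rewrite mxE.
  apply/matrixP => l k; rewrite !mxE mderiv_msubst raddf_sum.
  apply: eq_bigr => a _; rewrite /= mevalM mxE mulrC hD mevalC meval_msubst.
  by congr (_ * _); apply: meval_eq => b; rewrite he0.
move=> p [y _ py]; apply: (AX (fun a => meval y (h a))); rewrite py; congr <[_]>%VS.
by apply/rowP => k; rewrite !mxE meval_msubst.
Qed.

End LowerBound.

(** * Minors and charts of the Grassmannian *)

Section Derivation.
Variables (S T : comNzRingType) (phi : {rmorphism S -> T}) (delta : S -> T).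
Hypothesis deltaD : forall a b, delta (a + b) = delta a + delta b.
Hypothesis deltaM : forall a b, delta (a * b) = delta a * phi b + phi a * delta b.

Lemma derivation0 : delta 0 = 0.
Proof. by apply: (addrI (delta 0)); rewrite -deltaD !addr0. Qed.

Lemma derivation1 : delta 1 = 0.
Proof. by apply: (addrI (delta 1)); rewrite addr0 -{3}[1]mulr1 deltaM rmorph1 mulr1 mul1r. Qed.

Lemma derivationN a : delta (- a) = - delta a.
Proof. by apply: (addrI (delta a)); rewrite -deltaD !subrr derivation0. Qed.

Lemma derivation_sum (I : Type) (s : seq I) (F : I -> S) :
  delta (\sum_(i <- s) F i) = \sum_(i <- s) delta (F i).
Proof. exact: (big_morph delta deltaD derivation0). Qed.

Lemma derivation_prod (I : eqType) (s : seq I) (F : I -> S) : uniq s ->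
  delta (\prod_(a <- s) F a) =
  \sum_(i <- s) \prod_(a <- s) (if a == i then delta (F a) else phi (F a)).
Proof.
elim: s => [|a s IHs] /=; first by rewrite !big_nil derivation1.
move=> /andP[as_ us]; rewrite !big_cons deltaM eqxx IHs // mulr_sumr.
congr (_ + _).
  congr (_ * _); rewrite rmorph_prod; apply: eq_big_seq => b bs.
  by case: eqP bs as_ => // -> ->.
apply: eq_big_seq => i is_; rewrite big_cons; case: eqP is_ as_ => // -> -> //.
Qed.

(** The Leibniz rule on each product of the expansion; reindexing by the permutation turns the
    differentiated row into a column. *)
Lemma derivation_det n (M : 'M[S]_n) :
  delta (\det M) =
  \sum_i \det (\matrix_(a, b) if b == i then delta (M a b) else phi (M a b)).
Proof.
rewrite /determinant derivation_sum exchange_big /=; apply: eq_bigr => s _.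
rewrite -mulr_sumr.
have -> : delta ((-1) ^+ s * \prod_i M i (s i)) = (-1) ^+ s * delta (\prod_i M i (s i)).
  by rewrite deltaM; case: (odd_perm s); rewrite ?expr0 ?expr1 ?derivationN derivation1
    ?oppr0 ?rmorphN rmorph1 mul0r add0r.
congr (_ * _); rewrite derivation_prod ?index_enum_uniq //.
rewrite [RHS](reindex_inj (@perm_inj _ s)); apply: eq_bigr => i _.
by apply: eq_bigr => a _; rewrite !mxE (inj_eq perm_inj).
Qed.

End Derivation.

Section Minor.
Variables (K : fieldType) (r n : nat).
Implicit Types (f q : 'I_r.+1 -> 'I_n.+1) (A B : 'M[K]_(r.+1, n.+1)).

Definition minor f A := \det (colsub f A).

(* The directional derivative of minor f at A along B. *)
Definition dminor f A B :=
  \sum_i \det (\matrix_(a, b) (if b == i then B else A) a (f b)).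

Lemma det_col_perm m (s : 'S_m) (M : 'M[K]_m) :
  \det (col_perm s M) = (-1) ^+ s * \det M.
Proof. by rewrite col_permE det_mulmx det_perm odd_permV mulrC. Qed.

Lemma minor_perm (s : 'S_r.+1) f A : minor (f \o s) A = (-1) ^+ s * minor f A.
Proof.
by rewrite -det_col_perm /minor; congr (\det _); apply/matrixP => a b; rewrite !mxE.
Qed.

Lemma dminor_perm (s : 'S_r.+1) f A B :
  dminor (f \o s) A B = (-1) ^+ s * dminor f A B.
Proof.
rewrite /dminor mulr_sumr [RHS](reindex_inj (@perm_inj _ s)); apply: eq_bigr => i _.
rewrite -det_col_perm; congr (\det _); apply/matrixP => a b.
by rewrite !mxE (inj_eq perm_inj).
Qed.

Lemma minor_mul f (M : 'M_r.+1) A : minor f (M *m A) = \det M * minor f A.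
Proof.
rewrite /minor -det_mulmx; congr (\det _).
by apply/matrixP => a b; rewrite !mxE; apply: eq_bigr => i _; rewrite !mxE.
Qed.

Lemma minorZ f c A : minor f (c *: A) = c ^+ r.+1 * minor f A.
Proof.
by rewrite -detZ; congr (\det _); apply/matrixP => a b; rewrite !mxE.
Qed.

Lemma minor_row_free f A : minor f A != 0 -> row_free A.
Proof.
rewrite -unitfE -[_ \is a _]/(colsub f A \in unitmx) -row_free_unit /row_free => /eqP fA.
have fE : colsub f A = A *m colsub f 1%:M.
  apply/matrixP => a b; rewrite !mxE (bigD1 (f b)) //= !mxE eqxx mulr1 big1 ?addr0 //.
  by move=> i ib; rewrite !mxE (negPf ib) mulr0.
by rewrite eqn_leq rank_leq_row -{1}fA fE mxrankM_maxl.
Qed.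

Lemma det_col0 m (M : 'M[K]_m) j : (forall i, M i j = 0) -> \det M = 0.
Proof.
by move=> M0; rewrite (expand_det_col M j) big1 // => i _; rewrite M0 mul0r.
Qed.

Lemma dminor_eq0 f A B i j : i != j ->
  (forall a, A a (f i) = 0) -> (forall a, A a (f j) = 0) -> dminor f A B = 0.
Proof.
move=> ij Ai Aj; apply: big1 => l _.
case: (eqVneq i l) => [il|il].
  by apply: (@det_col0 _ _ j) => a; rewrite mxE -il eq_sym (negPf ij).
by apply: (@det_col0 _ _ i) => a; rewrite mxE (negPf il).
Qed.

Lemma det_unit_col m (M : 'M[K]_m) i :
  (forall a b, b != i -> M a b = (a == b)%:R) -> \det M = M i i.
Proof.
move=> M1; rewrite (expand_det_col M i) (eq_bigr (fun a => M a i * (\adj 1%:M) i a)).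
  rewrite adj1 (bigD1 i) //= big1 ?addr0 => [|a ai]; first by rewrite mxE eqxx mulr1.
  by rewrite mxE eq_sym (negPf ai) mulr0.
move=> a _; rewrite mxE; congr (_ * (_ * \det _)).
by apply/matrixP => b c; rewrite !mxE M1 // eq_sym neq_lift.
Qed.

(** Reads one entry of [B] off a minor: the term of column [i] gives the entry, and every other term
    has a zero column, from [B] or from [A]. *)
Lemma dminor_unit_col f A B i :
  (forall b, b != i -> forall a, A a (f b) = (a == b)%:R) ->
  (forall b, b != i -> (forall a, B a (f b) = 0) \/ (forall a, A a (f i) = 0)) ->
  dminor f A B = B i (f i).
Proof.
move=> A1 AB; rewrite /dminor (bigD1 i) //= big1 ?addr0.
  rewrite (@det_unit_col _ _ i) => [|a b bi]; first by rewrite mxE eqxx.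
  by rewrite mxE (negPf bi) A1.
move=> j ji; have [B0|A0] := AB j ji.
  by apply: (@det_col0 _ _ j) => a; rewrite mxE eqxx B0.
by apply: (@det_col0 _ _ i) => a; rewrite mxE eq_sym (negPf ji) A0.
Qed.

End Minor.

Section Plucker.
Variables (R : realType) (r n : nat).
Local Notation C := (R[i]).
Hypothesis le_rn : (r <= n)%N.

Definition plucker_cols (k : 'I_(plucker_dim r n).+1) (j : 'I_r.+1) : 'I_n.+1 :=
  nth ord0 (enum (plucker_index k)) j.

Lemma plucker_vecE A k : plucker_vec A 0 k = minor (plucker_cols k) A :> C.
Proof. by rewrite mxE. Qed.

Lemma plucker_dimS : (plucker_dim r n).+1 = 'C(n.+1, r.+1).
Proof. by rewrite prednK // bin_gt0. Qed.

Lemma size_plucker_sets :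
  size (enum [pred S : {set 'I_n.+1} | #|S| == r.+1]) = (plucker_dim r n).+1.
Proof.
rewrite plucker_dimS -cardE -[n.+1 in RHS]card_ord -card_draws.
by apply: eq_card => S; rewrite !inE.
Qed.

Lemma card_plucker_index (k : 'I_(plucker_dim r n).+1) : #|plucker_index k| = r.+1.
Proof.
have : plucker_index k \in enum [pred S : {set 'I_n.+1} | #|S| == r.+1].
  by apply: mem_nth; rewrite size_plucker_sets.
by rewrite mem_enum => /eqP.
Qed.

Lemma plucker_cols_inj k : injective (plucker_cols k).
Proof.
move=> i j /eqP; rewrite nth_uniq ?enum_uniq -?cardE ?card_plucker_index //.
by move=> /eqP/val_inj.
Qed.

(** Lets minors be taken along columns in any order, since a permutation only changes their sign. *)
Lemma plucker_colsP (f : 'I_r.+1 -> 'I_n.+1) : injective f ->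
  exists k (s : 'S_r.+1), f =1 plucker_cols k \o s.
Proof.
move=> f_inj; pose S := [set f i | i : 'I_r.+1]%SET.
have cS : #|S| = r.+1 by rewrite card_imset ?card_ord.
have Sin : S \in enum [pred S : {set 'I_n.+1} | #|S| == r.+1] by rewrite mem_enum inE cS.
have kS : (index S (enum [pred S : {set 'I_n.+1} | #|S| == r.+1]) < (plucker_dim r n).+1)%N.
  by rewrite -size_plucker_sets index_mem.
pose k := Ordinal kS; have kE : plucker_index k = S by rewrite /plucker_index nth_index.
have fS i : f i \in enum S by rewrite mem_enum imset_f.
have ltS i : (index (f i) (enum S) < r.+1)%N by rewrite -cS cardE index_mem.
pose g i := Ordinal (ltS i).
have g_inj : injective g.
  move=> i j /(congr1 val) /= e; apply: f_inj.
  by rewrite -(nth_index ord0 (fS i)) e nth_index.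
exists k, (perm g_inj) => i /=; rewrite permE /plucker_cols kE.
by rewrite nth_index.
Qed.

(* Matrices with t times the identity in the columns q, e enumerating the
   other columns. *)
Definition chart (S : comNzRingType) (q : 'I_r.+1 -> 'I_n.+1) (e : 'I_(n - r) -> 'I_n.+1)
    (t : S) (b : 'I_r.+1 -> 'I_(n - r) -> S) : 'M[S]_(r.+1, n.+1) :=
  \matrix_(i, c) (t * (c == q i)%:R + \sum_l b i l * (c == e l)%:R).

Lemma map_chart (S T : comNzRingType) (phi : {rmorphism S -> T}) q e t b :
  map_mx phi (chart q e t b) = chart q e (phi t) (fun i l => phi (b i l)).
Proof.
apply/matrixP => i c; rewrite !mxE rmorphD rmorphM rmorph_nat rmorph_sum.
by congr (_ + _); apply: eq_bigr => l _; rewrite rmorphM rmorph_nat.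
Qed.

Definition complementary (q : 'I_r.+1 -> 'I_n.+1) (e : 'I_(n - r) -> 'I_n.+1) :=
  [/\ injective e, forall i l, q i != e l &
      forall c, (exists i, c = q i) \/ (exists l, c = e l)].

Lemma complementaryP q : injective q -> exists e, complementary q e.
Proof.
move=> q_inj; pose S := ~: [set q i | i : 'I_r.+1]%SET.
have cS : #|S| = (n - r)%N by rewrite cardsCs finset.setCK card_imset ?card_ord // subSS.
exists (fun l => enum_val (cast_ord (esym cS) l)); split=> [l l'|i l|c].
- by move/enum_val_inj/cast_ord_inj.
- apply: contraTneq (enum_valP (cast_ord (esym cS) l)) => <-.
  by rewrite inE negbK imset_f.
case: (boolP (c \in S)) => cS'.
  by right; exists (cast_ord cS (enum_rank_in cS' c)); rewrite cast_ordK enum_rankK_in.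
by move: cS'; rewrite inE negbK => /imsetP[i _ ->]; left; exists i.
Qed.

Lemma chartE (S : comNzRingType) q e (t : S) (M : 'M[S]_(r.+1, n.+1)) :
  injective q -> complementary q e -> colsub q M = t%:M ->
  M = chart q e t (fun i l => M i (e l)).
Proof.
move=> q_inj [e_inj qe cov] /matrixP qM; apply/matrixP => i c; rewrite mxE.
have [[j ->]|[l ->]] := cov c.
  rewrite (inj_eq q_inj) big1 ?addr0 => [|l _]; last by rewrite (negPf (qe _ _)) mulr0.
  by have := qM i j; rewrite !mxE => ->; rewrite eq_sym mulr_natr.
rewrite eq_sym (negPf (qe _ _)) mulr0 add0r (bigD1 l) //= eqxx mulr1 big1 ?addr0 //.
by move=> l' l'l; rewrite (inj_eq e_inj) eq_sym (negPf l'l) mulr0.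
Qed.

Lemma colsub_chart (S : comNzRingType) q e (t : S) b :
  injective q -> complementary q e -> colsub q (chart q e t b) = t%:M.
Proof.
move=> q_inj [_ qe _]; apply/matrixP => i j; rewrite !mxE (inj_eq q_inj) big1 ?addr0.
  by rewrite mulr_natr eq_sym.
by move=> l _; rewrite (negPf (qe _ _)) mulr0.
Qed.

Lemma chart_free q e (t : C) b : injective q -> complementary q e ->
  chart q e t b = 0 -> t = 0 /\ (forall i l, b i l = 0).
Proof.
move=> q_inj qe M0; have := colsub_chart t b q_inj qe; rewrite M0 => /matrixP t0.
split; first by have := t0 0 0; rewrite !mxE eqxx.
move=> i l; have [e_inj qe' _] := qe.
move/matrixP: M0 => /(_ i (e l)); rewrite !mxE eq_sym (negPf (qe' _ _)) mulr0 add0r.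
rewrite (bigD1 l) //= eqxx mulr1 big1 ?addr0 // => l' l'l.
by rewrite (inj_eq e_inj) eq_sym (negPf l'l) mulr0.
Qed.

(** Where the Plücker coordinate of the columns [q] is nonzero, the matrix can be normalized to the
    identity in these columns; its other entries are the parameters. *)
Lemma grassmannian_dimension_le :
  (dimension (grassmannian R r n) <= (r.+1 * (n - r))%N%:R%:E)%E.
Proof.
apply: dimension_le => p v [A Afree pA] pv.
have v0 := span_neq0 pv.
have [k vk] : exists k, v 0 k != 0.
  apply/existsP; apply: contraNT v0; rewrite negb_exists => /forallP v0.
  by apply/eqP/rowP => k; rewrite mxE; apply/eqP/negPn/v0.
exists k => //; pose q := plucker_cols k; have q_inj : injective q := @plucker_cols_inj k.
have [e qe] := complementaryP q_inj.
pose M : 'M[mpoly (r.+1 * (n - r)) C]_(r.+1, n.+1) :=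
  chart q e 1 (fun i l => mpolyX C (mnm1 (mxvec_index i l))).
exists (fun k => \det (colsub (plucker_cols k) M)) => p' w [A' _ p'A] p'w wk.
have /vlineP[c wE] : w \in <[plucker_vec A']>%VS by rewrite -p'A p'w memv_line.
have A'k : c * minor q A' = 1 by rewrite -plucker_vecE -wk wE [RHS]mxE.
have A'q : colsub q A' \in unitmx.
  rewrite unitmxE unitfE -/(minor q A'); apply: contra_eq_neq A'k => ->.
  by rewrite mulr0 eq_sym oner_neq0.
pose M' := invmx (colsub q A') *m A'.
have wM i : w 0 i = minor (plucker_cols i) M'.
  rewrite minor_mul det_inv wE mxE plucker_vecE -/(minor q A').
  congr (_ * _); apply: (mulIf (_ : minor q A' != 0)).
    by apply: contra_eq_neq A'k => ->; rewrite mulr0 eq_sym oner_neq0.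
  by rewrite A'k mulVf //; apply: contra_eq_neq A'k => ->; rewrite mulr0 eq_sym oner_neq0.
have M'q : colsub q M' = 1%:M.
  rewrite -(mulVmx A'q); apply/matrixP => a b; rewrite !mxE.
  by apply: eq_bigr => l _; rewrite !mxE.
exists (fun l => mxvec (colsub e M') 0 l) => i; rewrite wM -det_map_mx /minor.
congr (\det _); rewrite map_mxsub map_chart rmorph1 [in LHS](chartE q_inj qe M'q).
congr (colsub _ (chart _ _ _ _)); apply/funext => a; apply/funext => l.
by rewrite /= mevalXU mxvecE [RHS]mxE.
Qed.

End Plucker.

(** * Independent tangent spaces *)

Section Terracini.
Variables (R : realType) (r n : nat).
Local Notation C := (R[i]).
Local Notation N := (plucker_dim r n).
Hypothesis le_rn : (r <= n)%N.

(** [dimension_ge] for a number of parameters, such as [#|{: I}|] below, that is not written as a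
    successor. *)
Lemma dimension_ge_params s e (psi : 'I_N.+1 -> mpoly s C) (x : 'I_s -> C)
    (X : set (proj R N)) : (0 < e)%N ->
  (forall k c v, meval (fun j => c * v j) (psi k) = c ^+ e * meval v (psi k)) ->
  (exists l, x l != 0) ->
  (forall z : 'I_s -> C,
     (forall k, \sum_l z l * meval x (mderiv l (psi k)) = 0) -> forall l, z l = 0) ->
  (forall y p, val p = <[\row_k meval y (psi k)]>%VS -> X p) ->
  (s.-1%:R%:E <= dimension X)%E.
Proof.
move=> e0 hpsi xn0 xinj AX; case: s psi x hpsi xn0 xinj AX => [|m] psi x hpsi xn0 xinj AX.
  by case: xn0 => -[].
exact: dimension_ge e0 hpsi xn0 xinj AX.
Qed.

Lemma proj_of_plucker (A : 'M[C]_(r.+1, n.+1)) : plucker_vec A != 0 ->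
  exists2 p, grassmannian R r n p & val p = <[plucker_vec A]>%VS.
Proof.
move=> A0; exists (proj_of A0) => //; exists A => //.
have [k Ak] : exists k, plucker_vec A 0 k != 0.
  apply/existsP; apply: contraNT A0; rewrite negb_exists => /forallP A0.
  by apply/eqP/rowP => k; rewrite [RHS]mxE; apply/eqP/negPn/A0.
by move: Ak; rewrite plucker_vecE; apply: minor_row_free.
Qed.

Section Points.
Variables (k : nat) (A : 'I_k -> 'M[C]_(r.+1, n.+1)) (q : 'I_k -> 'I_r.+1 -> 'I_n.+1).
Hypothesis k_gt0 : (0 < k)%N.
Hypothesis q_inj : forall j, injective (q j).
Hypothesis qA : forall j, colsub (q j) (A j) = 1%:M.

(* The affine tangent spaces to the cone over the Grassmannian at the points
   of the A j are independent. *)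
Hypothesis tangent_free : forall B : 'I_k -> 'M[C]_(r.+1, n.+1),
  (forall j, exists t, colsub (q j) (B j) = t%:M) ->
  (forall f, injective f -> \sum_j dminor f (A j) (B j) = 0) ->
  forall j, B j = 0.

(** The parameters of the [j]th cone: [None] is the scale, [Some (i, l)] an entry of the affine
    chart. *)
Let I := ('I_k * option ('I_r.+1 * 'I_(n - r)))%type.

Let card_I : #|{: I}| = (k * (r.+1 * (n - r)).+1)%N.
Proof. by rewrite card_prod card_option card_prod !card_ord. Qed.

Let e j := sval (cid (complementaryP (@q_inj j))).
Let eP j : complementary (q j) (e j).
Proof. exact: svalP (cid (complementaryP (@q_inj j))). Qed.

Let param (S : comNzRingType) (z : 'I_#|{: I}| -> S) j : 'M[S]_(r.+1, n.+1) :=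
  chart (q j) (e j) (z (enum_rank ((j, None) : I)))
    (fun i l => z (enum_rank ((j, Some (i, l)) : I))).

Let map_param (S T : comNzRingType) (phi : {rmorphism S -> T}) z j :
  map_mx phi (param z j) = param (phi \o z) j.
Proof. exact: map_chart. Qed.

Let paramZ (c : C) z j : param (fun l => c * z l) j = c *: param z j.
Proof.
apply/matrixP => a b; rewrite !mxE mulrDr mulr_sumr mulrA; congr (_ + _).
by apply: eq_bigr => l _; rewrite mulrA.
Qed.

Let X := param (fun l => mpolyX C (mnm1 l)).

Let psi (i : 'I_N.+1) := \sum_j \det (colsub (plucker_cols i) (X j)).

Let meval_X y j : map_mx (meval y) (X j) = param y j.
Proof.
rewrite map_param; congr (chart _ _ _ _); first by rewrite /= mevalXU.
by apply/funext => a; apply/funext => b; rewrite /= mevalXU.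
Qed.

Let psiE y i : meval y (psi i) = \sum_j minor (plucker_cols i) (param y j).
Proof.
rewrite raddf_sum; apply: eq_bigr => j _; rewrite /= -det_map_mx; congr (\det _).
by rewrite map_mxsub meval_X.
Qed.

Let x (l : 'I_#|{: I}|) : C :=
  let: (j, o) := enum_val l in if o is Some (i, c) then A j i (e j c) else 1.

Let param_x j : param x j = A j.
Proof.
rewrite [RHS](chartE (@q_inj j) (eP j) (qA j)); congr (chart _ _ _ _).
  by rewrite /x enum_rankK.
by apply/funext => a; apply/funext => b; rewrite /x enum_rankK.
Qed.

Let psi_deriv z i : \sum_l z l * meval x (mderiv l (psi i)) =
  \sum_j dminor (plucker_cols i) (A j) (param z j).
Proof.
(* The derivative at [x] in the direction [z] is a derivation over the evaluation at [x], so
   [derivation_det] applies. *)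
pose delta (p : mpoly #|{: I}| C) := \sum_l z l * meval x (mderiv l p).
have deltaD p p' : delta (p + p') = delta p + delta p'.
  by rewrite -big_split; apply: eq_bigr => l _; rewrite /= mderivD mevalD mulrDr.
have deltaM p p' : delta (p * p') = delta p * meval x p' + meval x p * delta p'.
  rewrite mulr_suml mulr_sumr -big_split; apply: eq_bigr => l _.
  by rewrite /= mderivM mevalD !mevalM mulrDr !mulrA [meval x p * z l]mulrC.
have deltaX l : delta (mpolyX C (mnm1 l)) = z l.
  rewrite /delta (bigD1 l) //= big1 ?addr0 => [|l' l'l].
    rewrite mderivX mnm1E eqxx scale1r (_ : mnm_sub _ _ = @mnm0 _) ?mpolyX0 ?meval1 ?mulr1 //.
    by apply/mnmP => a; rewrite mnmBE mnm0E subnn.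
  by rewrite mderivX mnm1E eq_sym (negPf l'l) scale0r meval0 mulr0.
have delta_nat p m : delta (p * m%:R) = delta p * m%:R.
  rewrite deltaM rmorph_nat; suff -> : delta m%:R = 0 by rewrite mulr0 addr0.
  by apply: big1 => l _; rewrite -mpolyC_nat mderivC meval0 mulr0.
rewrite -/(delta (psi i)) (derivation_sum deltaD).
apply: eq_bigr => j _; rewrite (derivation_det deltaD deltaM).
apply: eq_bigr => c _; congr (\det _); apply/matrixP => a b; rewrite !mxE.
case: ifP => _; last by rewrite -[A j]param_x -(meval_X x) !mxE.
rewrite !mxE deltaD delta_nat deltaX; congr (_ + _).
rewrite (derivation_sum deltaD); apply: eq_bigr => l _.
by rewrite delta_nat deltaX.
Qed.

(** [psi] sums [k] Plücker vectors, so its image lies in the secant variety, and [tangent_free]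
    makes its derivative at [x] injective. *)
Lemma secant_dimension_ge :
  ((k * (r.+1 * (n - r)).+1).-1%:R%:E <= dimension (secant_variety k (grassmannian R r n)))%E.
Proof.
rewrite -card_I; apply: (@dimension_ge_params _ r.+1 psi x) => //.
- move=> i c v; rewrite !psiE mulr_sumr; apply: eq_bigr => j _.
  by rewrite paramZ minorZ.
- exists (enum_rank ((Ordinal k_gt0, None) : I)); rewrite /x enum_rankK.
  exact: oner_neq0.
- move=> z z0 l; rewrite -[l]enum_valK; case: (enum_val l) => j o.
  have Bz : param z j = 0.
    apply: (tangent_free (B := param z)) => [j'|f f_inj].
      by eexists; apply: colsub_chart (@q_inj j') (eP j').
    have [i [s fE]] := plucker_colsP le_rn f_inj; rewrite (funext fE).
    under eq_bigr do rewrite dminor_perm.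
    by rewrite -mulr_sumr -psi_deriv z0 mulr0.
  have [z1 z2] := chart_free (@q_inj j) (eP j) Bz.
  by case: o => [[a b]|]; [apply: z2|apply: z1].
move=> y p py; apply: sub_gen_smallest.
(* Where the Plücker vector vanishes, the point of [A j] stands in for it. *)
have pt j : exists p', grassmannian R r n p' /\ plucker_vec (param y j) \in val p'.
  have [y0|/proj_of_plucker[p' Gp' p'y]] := eqVneq (plucker_vec (param y j)) 0.
    have [|p' Gp' _] := @proj_of_plucker (A j); last by exists p'; rewrite y0 mem0v.
    have [i [s qE]] := plucker_colsP le_rn (@q_inj j).
    apply: contra_eq_neq (congr1 determinant (qA j)) => /rowP/(_ i).
    rewrite plucker_vecE mxE -/(minor (q j) (A j)) (funext qE) minor_perm => ->.
    by rewrite mulr0 det1 eq_sym oner_neq0.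
  by exists p'; split => //; rewrite p'y memv_line.
have [P PP] := choice pt; exists P => [j|]; first by have [] := PP j.
rewrite py -memvE (_ : \row_i _ = \sum_j plucker_vec (param y j)).
  by apply: memv_sumr => j _; have [] := PP j.
apply/rowP => i; rewrite mxE psiE summxE; apply: eq_bigr => j _.
by rewrite plucker_vecE.
Qed.

(** With [D = (r + 1) * (n - r)], the secant variety has dimension at least [k * D + k - 1], and the
    Grassmannian at most [D]. *)
Lemma not_defective_of_tangents : ~ defective k (grassmannian R r n).
Proof.
rewrite /defective; apply/negP; rewrite -leNgt.
apply: le_trans (secant_dimension_ge).
rewrite ge_min; apply/orP; left.
have kD : ((k%:R)%:E * dimension (grassmannian R r n) <= (k * (r.+1 * (n - r)))%N%:R%:E)%E.
  rewrite natrM EFinM; apply: lee_wpmul2l; first by rewrite lee_fin ler0n.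
  exact: grassmannian_dimension_le.
apply: le_trans (leeD (leeD kD (lexx _)) (lexx _)) _.
rewrite -!EFinD lee_fin -natrD -mulnSr -subn1 natrB //.
by rewrite muln_gt0 k_gt0.
Qed.

End Points.
End Terracini.

(** * Choice of the points *)

Section CoordinateTangent.
Variables (K : numFieldType) (r n : nat).
Implicit Types (f s : 'I_r.+1 -> 'I_n.+1) (B : 'M[K]_(r.+1, n.+1)).

Definition coord_mx s : 'M[K]_(r.+1, n.+1) := \matrix_(i, c) (c == s i)%:R.

Lemma colsub_coord_mx s : injective s -> colsub s (coord_mx s) = 1%:M.
Proof.
by move=> s_inj; apply/matrixP => i j; rewrite !mxE (inj_eq s_inj) eq_sym.
Qed.

Lemma coord_mx0 s i c : c \notin codom s -> coord_mx s i c = 0.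
Proof.
by move=> cs; rewrite mxE; case: eqP cs => // ->; rewrite codom_f.
Qed.

Lemma dminor_scalar f (A : 'M[K]_(r.+1, n.+1)) B t : colsub f A = 1%:M ->
  colsub f B = t%:M -> dminor f A B = t *+ r.+1.
Proof.
move=> /matrixP fA /matrixP fB; rewrite /dminor.
rewrite (eq_bigr (fun=> t)) ?sumr_const ?card_ord // => i _.
rewrite (@det_unit_col _ _ _ i) => [|a b bi]; rewrite mxE.
  by rewrite eqxx; have := fB i i; rewrite !mxE eqxx.
by rewrite (negPf bi); have := fA a b; rewrite !mxE.
Qed.

(** Two columns of the minor are zero, and differentiation replaces only one of them. *)
Lemma dminor_coord_eq0 f s B :
  (#|[set b | f b \in codom s]%SET| < r)%N -> dminor f (coord_mx s) B = 0.
Proof.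
move=> fs; have : (1 < #|~: [set b | f b \in codom s]%SET|)%N.
  by rewrite cardsCs finset.setCK card_ord; lia.
move=> /card_gt1P[i [j [+ + ij]]]; rewrite !inE => fi fj.
by apply: (dminor_eq0 _ ij) => a; apply: coord_mx0.
Qed.

Definition replace (T : Type) (s : 'I_r.+1 -> T) (i : 'I_r.+1) (c : T) (b : 'I_r.+1) :=
  if b == i then c else s b.

Lemma replace_inj (T : eqType) (s : 'I_r.+1 -> T) i c :
  (forall b b', b != i -> b' != i -> s b = s b' -> b = b') ->
  (forall b, b != i -> s b != c) -> injective (replace s i c).
Proof.
move=> s_inj sc b b'; rewrite /replace.
case: eqP => [->|/eqP bi]; case: eqP => [->|/eqP b'i] //.
- by move=> /esym/eqP; rewrite (negPf (sc _ b'i)).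
- by move=> /eqP; rewrite (negPf (sc _ bi)).
exact: s_inj.
Qed.

(** [f = s] gives [t = 0], by characteristic zero; the minor with [s i] replaced by [c] reads off
    the entry [B i c]. *)
Lemma coord_tangent_eq0 s B t : injective s -> colsub s B = t%:M ->
  (forall f, injective f -> (exists i, forall b, b != i -> f b = s b) ->
     dminor f (coord_mx s) B = 0) ->
  B = 0.
Proof.
move=> s_inj sB fB.
have t0 : t = 0.
  have /eqP := fB s s_inj (ex_intro _ ord0 (fun _ _ => erefl)).
  by rewrite (dminor_scalar (colsub_coord_mx s_inj) sB) mulrn_eq0 /= => /eqP.
apply/matrixP => i c; rewrite mxE; case: (boolP (c \in codom s)) => [/codomP[j ->]|cs].
  by move/matrixP: sB => /(_ i j); rewrite !mxE t0 mul0rn.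
have sc b : s b != c by apply: contraNneq cs => <-; apply: codom_f.
have repE b : b != i -> replace s i c b = s b by rewrite /replace => /negPf->.
have ri : replace s i c i = c by rewrite /replace eqxx.
have rep_inj := replace_inj (fun b b' _ _ => @s_inj b b') (fun b (_ : b != i) => sc b).
have <- := fB (replace s i c) rep_inj (ex_intro _ i repE).
rewrite (@dminor_unit_col _ _ _ _ _ _ i) ?ri // => b bi.
  by move=> a; rewrite repE // mxE (inj_eq s_inj) eq_sym.
by right=> a; rewrite coord_mx0.
Qed.

End CoordinateTangent.

Section Codes.
Variables (R : realType) (r n : nat).
Hypothesis le_rn : (r <= n)%N.

Lemma count_mem_sym (T : eqType) (s s' : seq T) : uniq s -> uniq s' ->
  count (mem s') s = count (mem s) s'.
Proof.
move=> us us'; rewrite -!size_filter; apply/perm_size/uniq_perm; rewrite ?filter_uniq //.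
by move=> x; rewrite !mem_filter andbC.
Qed.

(* Coordinate points whose index sets pairwise meet in at most r - 2 elements
   have tangent spaces spanned by disjoint sets of coordinate vectors. *)
Lemma not_defective_code (F : seq (seq nat)) k :
  (0 < k <= size F)%N ->
  (forall s, s \in F -> [/\ uniq s, size s = r.+1 & all (fun x => x < n.+1)%N s]) ->
  pairwise (fun s s' : seq nat => count (mem s') s + 2 <= r)%N F ->
  ~ defective k (grassmannian R r n).
Proof.
move=> /andP[k0 kF] FP Fpair.
pose S (j : 'I_k) := nth [::] F j.
have SF j : S j \in F by apply: mem_nth; apply: leq_trans (ltn_ord j) kF.
have Spair j j' : j != j' -> (count (mem (S j')) (S j) + 2 <= r)%N.
  move=> jj'; have szF (i : 'I_k) : (i < size F)%N := leq_trans (ltn_ord i) kF.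
  have /(pairwiseP [::]) FP' := Fpair.
  have [lt|lt|/val_inj e] := ltngtP j j'; last by rewrite e eqxx in jj'.
    by apply: (FP' j j'); rewrite ?inE.
  have [[uj _ _] [uj' _ _]] := (FP _ (SF j), FP _ (SF j')).
  by rewrite count_mem_sym //; apply: (FP' j' j); rewrite ?inE.
pose s j (i : 'I_r.+1) : 'I_n.+1 := inord (nth 0%N (S j) i).
have sE j i : s j i = nth 0%N (S j) i :> nat.
  have [_ szj /allP lt] := FP _ (SF j).
  by rewrite /s inordK //; apply: lt; apply: mem_nth; rewrite szj.
have s_inj j : injective (s j).
  move=> i i' /(congr1 val) /=; rewrite !sE => /eqP; have [uj szj _] := FP _ (SF j).
  by rewrite nth_uniq ?szj // => /eqP/val_inj.
have meet j j' : j != j' -> (#|[set b | s j b \in codom (s j')]%SET| + 2 <= r)%N.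
  move=> /Spair; apply: leq_trans; rewrite leq_add2r.
  have [[uj szj _] [uj' szj' _]] := (FP _ (SF j), FP _ (SF j')).
  rewrite -size_filter cardE -(size_map (fun b : 'I_r.+1 => nth 0%N (S j) b)).
  apply: uniq_leq_size.
    rewrite map_inj_uniq ?enum_uniq // => b b' /eqP.
    by rewrite nth_uniq ?szj // => /eqP/val_inj.
  move=> x /mapP[b]; rewrite mem_enum inE => /codomP[i' e] ->.
  rewrite mem_filter /= [X in _ && X]mem_nth ?szj // andbT -sE e sE.
  by rewrite mem_nth ?szj'.
apply: (@not_defective_of_tangents R r n le_rn k (fun j => coord_mx _ (s j)) s) => //.
  by move=> j; apply: colsub_coord_mx.
move=> B Bt B0 j; have [t jt] := Bt j.
apply: (coord_tangent_eq0 (s_inj j) jt) => f f_inj [i fi].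
have := B0 f f_inj; rewrite (bigD1 j) //= big1 ?addr0 // => j' j'j.
apply: dminor_coord_eq0; have := meet j j'; rewrite eq_sym => /(_ j'j).
(* As [f] differs from [s j] in one place, it meets the other index sets in at most [r - 1]
   elements. *)
suff : (#|[set b | f b \in codom (s j')]%SET| <=
        #|i |: [set b | s j b \in codom (s j')]%SET|)%N by rewrite cardsU1; lia.
apply/subset_leq_card/fintype.subsetP => b; rewrite !inE; case: eqVneq => //= bi.
by rewrite fi.
Qed.

End Codes.

(* Besides the coordinate planes of a disjoint blocks {3j, 3j + 1, 3j + 2} one
   takes the plane spanned by the e_i + e_(q i), i < 3, with q transversal to
   the blocks. The coordinates of its tangent vectors at triples transversal to
   the blocks determine them, and they vanish on the tangent spaces at the
   other points. *)
Lemma not_defective_planes (R : realType) (n a : nat) (q : 'I_3 -> 'I_n.+1) :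
  (0 < a)%N -> (3 * a <= n.+1)%N -> injective q ->
  (forall i, 3 <= q i)%N ->
  (forall i i', i != i' -> q i %/ 3 = q i' %/ 3 -> a <= q i %/ 3)%N ->
  ~ defective a.+1 (grassmannian R 2 n).
Proof.
move=> a0 an q_inj q3 qT.
pose s (j : nat) (i : 'I_3) : 'I_n.+1 := inord (3 * j + i).
have sE j i : (j < a)%N -> s j i = (3 * j + i)%N :> nat.
  by move=> ja; rewrite /s inordK //; have := ltn_ord i; lia.
have s_inj j : (j < a)%N -> injective (s j).
  move=> ja i i' /(congr1 val) /=; rewrite !sE // => e; apply: val_inj.
  exact: addnI e.
have sP j c : (j < a)%N -> c \in codom (s j) -> (c %/ 3 = j)%N.
  by move=> ja /codomP[i ->]; rewrite sE //; have := ltn_ord i; lia.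
pose A0 : 'M[R[i]]_(3, n.+1) := coord_mx _ (s 0%N) + coord_mx _ q.
have A0E x c : A0 x c = (c == s 0%N x)%:R + (c == q x)%:R by rewrite !mxE.
have sq x y : (s 0%N x == q y) = false.
  apply/negbTE/eqP => /(congr1 val) /=; rewrite sE // => e.
  by have := q3 y; rewrite -e /=; have := ltn_ord x; lia.
have A0q x y : A0 x (q y) = (x == y)%:R.
  by rewrite A0E eq_sym sq add0r (inj_eq q_inj) eq_sym.
have A0s x y : A0 x (s 0%N y) = (x == y)%:R.
  by rewrite A0E sq addr0 (inj_eq (s_inj 0%N a0)) eq_sym.
pose Q (j : 'I_a.+1) := if (j < a)%N then s j else q.
pose A (j : 'I_a.+1) := if (j < a)%N then coord_mx _ (s j) else A0.
have Q_inj j : injective (Q j) by rewrite /Q; case: ifP => // /s_inj.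
apply: (@not_defective_of_tangents R 2 n _ a.+1 A Q) => //; first by lia.
  rewrite /A /Q => j; case: ifP => [ja|_]; first exact: colsub_coord_mx (s_inj j ja).
  by apply/matrixP => x y; rewrite [LHS]mxE A0q mxE.
move=> B Bt B0.
have small j (f : 'I_3 -> 'I_n.+1) : (j < a)%N ->
    (forall b b', b != b' -> f b %/ 3 = f b' %/ 3 -> a <= f b %/ 3)%N ->
    (#|[set b | f b \in codom (s j)]%SET| < 2)%N.
  move=> ja fT; rewrite ltnS; apply/card_le1_eqP => b b'; rewrite !inE.
  move=> /(sP _ _ ja) bj /(sP _ _ ja) b'j; apply/eqP; apply: contraT => bb'.
  by have := fT b' b bb'; rewrite bj b'j => /(_ erefl); rewrite leqNgt ja.
have Bmax : B ord_max = 0.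
  pose B' := B ord_max; rewrite -/B'.
  have [t] := Bt ord_max; rewrite /Q ltnn -/B' => B't.
  have read (f : 'I_3 -> 'I_n.+1) : injective f ->
      (forall b b', b != b' -> f b %/ 3 = f b' %/ 3 -> a <= f b %/ 3)%N ->
      dminor f A0 B' = 0.
    move=> f_inj fT; have := B0 f f_inj; rewrite big_ord_recr /= big1 => [|j _].
      by rewrite add0r /A /= ltnn.
    by rewrite /A /= ltn_ord; apply/dminor_coord_eq0/small.
  have t0 : t = 0.
    have /eqP := read q q_inj qT; rewrite (dminor_scalar _ B't) ?mulrn_eq0 => [/eqP//|].
    by apply/matrixP => x y; rewrite [LHS]mxE A0q mxE.
  have B'q x y : B' x (q y) = 0.
    by move/matrixP: B't => /(_ x y); rewrite !mxE t0 mul0rn.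
  apply/matrixP => i c; rewrite [RHS]mxE.
  have [/codomP[y ->] //|cq] := boolP (c \in codom q).
  have qc b : q b != c by apply: contraNneq cq => <-; apply: codom_f.
  have rE (f : 'I_3 -> 'I_n.+1) : replace f i c i = c by rewrite /replace eqxx.
  have rN (f : 'I_3 -> 'I_n.+1) b : b != i -> replace f i c b = f b.
    by rewrite /replace => /negPf->.
  (* For [c] in block 0, the triple is [q] with [q i] replaced by [c]: it stays transversal, and
     [B'] is zero in the columns of [q]. *)
  have [c3|c3] := ltnP c 3.
    rewrite -(read (replace q i c)).
    - rewrite (@dminor_unit_col _ _ _ _ _ _ i) ?rE // => b bi; first by move=> x; rewrite rN.
      by left=> x; rewrite rN.
    - by apply: replace_inj => // b b' _ _; apply: q_inj.
    move=> b b'; rewrite /replace.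
    case: (eqVneq b i) => [->|bi]; case: (eqVneq b' i) => [_|b'i] //.
    - by move=> _ e; move: (q3 b'); rewrite -divn_gt0 // -e divn_small.
    - by move=> _ e; move: (q3 b); rewrite -divn_gt0 // e divn_small.
    exact: qT.
  have [i1 [i2 [i1i i2i i12 cov]]] : exists i1 i2 : 'I_3, [/\ i1 != i, i2 != i, i1 != i2 &
      forall b, b != i -> b = i1 \/ b = i2].
    exists (lift i ord0), (lift i ord_max).
    rewrite ![lift _ _ == i]eq_sym !neq_lift (inj_eq lift_inj); split=> // b.
    case: (unliftP i b) => [x ->|->]; last by rewrite eqxx.
    by case: x => [[|[|x]] x2] // _; [left|right]; congr (lift i _); apply: val_inj.
  (* The triple [c], [q u], [s 0 v]: the last two are unit columns of [A0], column [c] of [A0] is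
     zero, and the block of [s 0 v] is 0. *)
  have main u v : u != i -> v != i -> u != v -> (forall b, b != i -> b = u \/ b = v) ->
      (q u %/ 3 = c %/ 3 -> a <= c %/ 3)%N -> B' i c = 0.
    move=> ui vi uv cov' uc; pose g b := if b == u then q u else s 0%N v.
    have gs b : b != i -> g b = q b /\ b = u \/ g b = s 0%N b /\ b = v.
      rewrite /g => /cov'[]->; first by left; rewrite eqxx.
      by right; rewrite eq_sym (negPf uv).
    rewrite -(read (replace g i c)).
    - rewrite (@dminor_unit_col _ _ _ _ _ _ i) ?rE // => b bi.
        by move=> x; rewrite rN //; have [[-> _]|[-> _]] := gs b bi.
      right=> x; rewrite A0E [c == q x]eq_sym (negPf (qc x)) addr0.
      by case: eqP => // e; move: c3; rewrite e sE // leqNgt ltn_ord.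
    - apply: replace_inj => [b b' bi b'i|b bi].
        have [[-> ->]|[-> ->]] := gs b bi; have [[-> ->]|[-> ->]] := gs b' b'i => //.
          by move=> /esym/eqP; rewrite sq.
        by move=> /eqP; rewrite sq.
      have [[-> _]|[-> _]] := gs b bi; first exact: qc.
      by apply/eqP => e; move: c3; rewrite -e sE // leqNgt ltn_ord.
    have gu b : b != i -> (g b %/ 3 = q u %/ 3 /\ b = u \/ g b %/ 3 = 0 /\ b = v)%N.
      move=> bi; have [[-> ->]|[-> ->]] := gs b bi; [by left|right].
      by rewrite sE // divn_small //; apply: ltn_ord.
    have qu0 : (q u %/ 3)%N <> 0%N by apply/eqP; rewrite -lt0n divn_gt0.
    have c0 : (c %/ 3)%N <> 0%N by apply/eqP; rewrite -lt0n divn_gt0.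
    move=> b b'; rewrite /replace.
    case: (eqVneq b i) => [->|bi]; case: (eqVneq b' i) => [_|b'i] //.
    - by have [[-> _]|[-> _]] := gu b' b'i => _ // e; apply: uc.
    - by have [[-> _]|[-> _]] := gu b bi => _ e; [rewrite e; apply: uc|case: c0].
    have [[-> ->]|[-> ->]] := gu b bi; have [[-> ->]|[-> ->]] := gu b' b'i;
      rewrite ?eqxx // => _ e; by case: qu0.
  (* If [q i1] is in the block of [c], then [q i2] is not, unless this block lies beyond the first
     [a]. *)
  have [e|e] := eqVneq (q i1 %/ 3)%N (c %/ 3)%N; last first.
    by apply: (main i1 i2) => // /eqP; rewrite (negPf e).
  apply: (main i2 i1) => //; [by rewrite eq_sym|by move=> b /cov[]; [right|left]|].
  by rewrite -e => e'; apply: (qT i1 i2).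
move=> j; case: (ltnP j a) => ja; last first.
  by rewrite -Bmax; congr B; apply/val_inj/eqP; rewrite /= eqn_leq ja -ltnS ltn_ord.
have [t] := Bt j; rewrite /Q ja => jt.
apply: (coord_tangent_eq0 (s_inj j ja) jt) => f f_inj [i fi].
have := B0 f f_inj; rewrite (bigD1 j) //= big1 ?addr0 => [|j' j'j]; first by rewrite /A ja.
rewrite /A; case: ifP => j'a.
  apply: dminor_coord_eq0.
  suff : [set b | f b \in codom (s j')]%SET \subset [set i]%SET.
    by move=> /subset_leq_card; rewrite cards1.
  apply/fintype.subsetP => b; rewrite !inE; apply: contraLR => bi.
  apply/negP; rewrite fi // => /(sP _ _ j'a); have := sP _ _ ja (codom_f (s j) b) => -> jj'.
  by case/eqP: j'j; apply: val_inj.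
have -> : j' = ord_max by apply/val_inj/eqP; rewrite /= eqn_leq -ltnS ltn_ord leqNgt j'a.
rewrite Bmax; apply: big1 => c _; apply: (@det_col0 _ _ _ c) => x.
by rewrite mxE eqxx mxE.
Qed.

(** * Codes *)

Section Words.
Local Open Scope nat_scope.
Variables (r n a t : nat).
Hypothesis a_gt0 : 0 < a.
Hypothesis an : a * r.+1 <= n.+1.
Hypothesis tr : 2 * t <= r.

(* The word x_0 x_0 x_1 x_1 ... followed by the check digit sum x_i mod a,
   padded with zeros; its i-th letter c becomes the element i * a + c. *)
Definition letter (x : {ffun 'I_t -> 'I_a}) (i : nat) : nat :=
  if insub i./2 is Some l then x l else
  if i == 2 * t then (\sum_l x l) %% a else 0.

Definition word_set x := mkseq (fun i => i * a + letter x i) r.+1.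

Definition word_sets := [seq word_set x | x : {ffun 'I_t -> 'I_a}].

Lemma letter_lt x i : letter x i < a.
Proof.
rewrite /letter; case: insubP => [l _ _|_]; first exact: ltn_ord.
by case: ifP => _ //; rewrite ltn_mod.
Qed.

Lemma letter_div x i : (i * a + letter x i) %/ a = i.
Proof. by rewrite divnMDl // divn_small ?addn0 ?letter_lt. Qed.

Lemma size_word_sets : size word_sets = a ^ t.
Proof. by rewrite size_map -cardE card_ffun !card_ord. Qed.

Lemma mem_word_set x i c : c < a ->
  (i * a + c \in word_set x) = (i < r.+1) && (c == letter x i).
Proof.
move=> ca; apply/mapP/andP => [[j]|[ir /eqP ->]]; last by exists i; rewrite ?mem_iota.
rewrite mem_iota add0n => /= jr e.
have ij : i = j by rewrite -(letter_div x j) -e divnMDl // divn_small ?addn0.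
by rewrite ij; split=> //; apply/eqP; move: e; rewrite ij => /addnI.
Qed.

Lemma word_setP s : s \in word_sets ->
  [/\ uniq s, size s = r.+1 & all (fun x => x < n.+1) s].
Proof.
move=> /mapP[x _ ->]; split; last first.
- apply/allP => _ /mapP[i + ->]; rewrite mem_iota add0n => /= ir.
  apply: leq_trans an; apply: leq_trans (_ : i.+1 * a <= _); last first.
    by rewrite mulnC leq_mul2l ir orbT.
  by rewrite mulSn addnC ltn_add2r letter_lt.
- by rewrite size_mkseq.
rewrite map_inj_in_uniq ?iota_uniq // => i j _ _ /(congr1 (divn^~ a)).
by rewrite !letter_div.
Qed.

Lemma count_word_set x (P : pred nat) :
  count P (word_set x) = count (fun i => P (i * a + letter x i)) (iota 0 r.+1).
Proof. by rewrite count_map. Qed.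

(** Two changed letters already change four positions. A single changed letter changes its two
    copies and the check digit, because letters are less than [a]. *)
Lemma letters_differ x y : x != y ->
  exists s, [/\ uniq s, size s = 3 &
    forall i, i \in s -> i < r.+1 /\ letter x i != letter y i].
Proof.
move=> xy; have [l xyl] : exists l, x l != y l.
  apply/existsP; apply: contraNT xy; rewrite negb_exists => /forallP e.
  by apply/eqP/ffunP => l; apply/eqP; rewrite -[_ == _]negbK.
have letterE z (m : 'I_t) (b : bool) : letter z (b + 2 * m) = z m.
  rewrite /letter mul2n half_bit_double insubT //= => m_lt.
  by congr (nat_of_ord (z _)); apply: val_inj.
have lt_pos (m : 'I_t) (b : bool) : b + 2 * m < 2 * t.
  by have := ltn_ord m; case: b => /=; lia.
have diff (m : 'I_t) (b : bool) : x m != y m ->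
    b + 2 * m < r.+1 /\ letter x (b + 2 * m) != letter y (b + 2 * m).
  move=> xym; split; last by rewrite !letterE (inj_eq val_inj).
  by apply: leq_trans (lt_pos m b) (leqW tr).
have [[m ml xym]|same] := pselect (exists2 m, m != l & x m != y m).
  exists [:: false + 2 * l; true + 2 * l; false + 2 * m]; split=> // [|i].
    rewrite /= !inE !andbT; move: ml; rewrite -val_eqE /=; lia.
  by rewrite !inE => /or3P[] /eqP->; apply: diff.
exists [:: false + 2 * l; true + 2 * l; 2 * t]; split=> // [|i].
  by rewrite /= !inE; have := ltn_ord l; lia.
rewrite !inE => /or3P[] /eqP->; [exact: diff|exact: diff|split; first by rewrite ltnS].
have checkE z : letter z (2 * t) = (\sum_l z l) %% a.
  by rewrite /letter insubF ?eqxx // mul2n doubleK ltnn.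
rewrite !checkE (bigD1 l) //= [in X in _ != X](bigD1 l) //=.
have -> : \sum_(i | i != l) x i = \sum_(i | i != l) y i.
  apply: eq_bigr => m ml; congr nat_of_ord; apply/eqP; apply: contra_notT same => xym.
  by exists m.
by rewrite eqn_modDr !modn_small.
Qed.

(** Of [r + 1] positions at least three differ, and equal positions are the only common elements. *)
Lemma word_sets_meet : pairwise (fun s s' : seq nat => count (mem s') s + 2 <= r) word_sets.
Proof.
rewrite pairwise_map; have := enum_uniq {ffun 'I_t -> 'I_a}; rewrite uniq_pairwise.
apply: sub_pairwise => x y xy.
suff: count (mem (word_set y)) (word_set x) + 2 <= r by [].
rewrite count_word_set.
have [s [us s3 sP]] := letters_differ xy.
pose P i := letter x i == letter y i.
rewrite (@eq_in_count _ _ P) => [|i]; last first.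
  by rewrite mem_iota add0n => /= ir; rewrite [LHS]mem_word_set ?letter_lt ?ir.
rewrite -ltnS -[X in _ < X](size_iota 0) -(count_predC P) -addnS leq_add2l.
rewrite -s3 -size_filter; apply: uniq_leq_size => // i /sP[ir xyi].
by rewrite mem_filter mem_iota add0n ir leq0n !andbT; exact: xyi.
Qed.

Lemma not_defective_words (R : realType) (E : seq (seq nat)) k : r <= n ->
  0 < k <= a ^ t + size E ->
  (forall s, s \in E -> [/\ uniq s, size s = r.+1 & all (fun x => x < n.+1) s]) ->
  (forall x s, s \in E -> count (mem s) (word_set x) + 2 <= r) ->
  pairwise (fun s s' : seq nat => count (mem s') s + 2 <= r) E ->
  ~ defective k (grassmannian R r n).
Proof.
move=> rn kE EP EW Epair; apply: (not_defective_code rn (F := word_sets ++ E)).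
- by rewrite size_cat size_word_sets.
- by move=> s; rewrite mem_cat => /orP[/word_setP|/EP].
rewrite pairwise_cat word_sets_meet Epair !andbT; apply/allrelP => s s'.
by move=> /mapP[x _ ->] /EW.
Qed.

End Words.

(** * Bounds on [hfun] and on [h] *)

Section HfunBounds.
Local Open Scope nat_scope.

(** [hfun m k] is a sum of distinct powers [m ^ i] with [i < s], so it is at most the geometric
    sum. *)
Lemma hfun_bound m k s : 0 < m -> k.+1 < 2 ^ s.+1 -> m.-1 * hfun m k < m ^ s.
Proof.
move=> m0 ks; have -> : m ^ s = (m.-1 * \sum_(i < s) m ^ i).+1.
  by rewrite -predn_exp prednK // expn_gt0 m0.
rewrite ltnS leq_mul2l; apply/orP; right; rewrite /hfun.
have odd_lt i : odd (k.+1 %/ 2 ^ i) -> i < s.+1.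
  move=> oi; rewrite -(ltn_exp2l _ _ (ltnSn 1)); apply: leq_ltn_trans ks.
  by rewrite leqNgt; apply: contraL oi => /divn_small ->.
rewrite -(big_mkord xpredT (fun i => m ^ i)).
rewrite -[X in _ <= X](big_add1 _ _ 0 s.+1 xpredT (fun i => m ^ i.-1)).
rewrite (big_nat_widen _ _ (maxn k.+2 s.+1)) ?leq_maxl //.
rewrite [X in _ <= X](big_nat_widen _ _ (maxn k.+2 s.+1)) ?leq_maxr //.
rewrite big_mkcond [X in _ <= X]big_mkcond leq_sum // => i _.
by case: andP => // -[/odd_lt -> _].
Qed.

Lemma hfun1 m : hfun m 1 = 1.
Proof. by rewrite (@hfunE m 1 [:: 1] false) ?big_seq1. Qed.
Lemma hfun2 m : hfun m 2 = 1.
Proof. by rewrite (@hfunE m 2 [:: 1] true) ?big_seq1. Qed.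
Lemma hfun3 m : hfun m 3 = m.
Proof. by rewrite (@hfunE m 3 [:: 2] false) ?big_seq1 ?expn1. Qed.
Lemma hfun4 m : hfun m 4 = m.
Proof. by rewrite (@hfunE m 4 [:: 2] true) ?big_seq1 ?expn1. Qed.
Lemma hfun5 m : hfun m 5 = m.+1.
Proof. by rewrite (@hfunE m 5 [:: 2; 1] false) ?big_cons ?big_nil ?expn1 ?addn0 ?addn1. Qed.
Lemma hfun6 m : hfun m 6 = m.+1.
Proof. by rewrite (@hfunE m 6 [:: 2; 1] true) ?big_cons ?big_nil ?expn1 ?addn0 ?addn1. Qed.

(** With [s = trunc_log 2 r], the bound on [h] mostly splits into two terms below [a ^ s], and
    [2 * a ^ s <= a ^ s.+1]. *)
Lemma secant_bound_lt_pow (r n h : nat) (a := (n + 1) %/ (r + 1)) :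
  2 <= r -> 2 * r + 1 <= n ->
  (r ^ 2 + 3 * r + 1 <= n /\ h <= a * hfun a (r - 1))
  \/ [/\ n < r ^ 2 + 3 * r + 1, ~~ odd r &
        h <= (a - 1) * hfun a (r - 1) + hfun a (n - 2 - a * r)]
  \/ [/\ n < r ^ 2 + 3 * r + 1, odd r &
        h <= (a - 1) * hfun a (r - 2)
             + hfun a (minn (n - 3 - a * (r - 1)) (r - 2))] ->
  h < a ^ (trunc_log 2 r).+1.
Proof.
move=> r2 rn.
have a2 : 2 <= a by rewrite leq_divRL; lia.
have an : a * (r + 1) <= n + 1 by apply: leq_trunc_div.
have na : n + 1 < a.+1 * (r + 1) by apply: ltn_ceil; lia.
clearbody a.
have /andP[_ rs] := @trunc_log_bounds 2 r isT (ltnW r2).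
set s := trunc_log 2 r in rs *.
have P2 : 2 * a ^ s <= a ^ s.+1 by rewrite expnS leq_mul2r a2 orbT.
have bound k : k < r -> hfun a k <= (a - 1) * hfun a k < a ^ s.
  move=> kr; rewrite leq_pmull ?subn_gt0 //= subn1 hfun_bound //; first by lia.
  exact: leq_ltn_trans kr rs.
case=> [[_ h_le]|[[nr _ h_le]|[nr _ h_le]]].
- have /andP[u1 u2] := bound (r - 1) ltac:(lia).
  have e : a * hfun a (r - 1) = hfun a (r - 1) + (a - 1) * hfun a (r - 1).
    by rewrite -mulSn [a - 1]subn1 prednK //; lia.
  by rewrite e in h_le; lia.
- have /andP[_ u2] := bound (r - 1) ltac:(lia).
  (* For [a >= 3] the argument [n - 2 - a * r] can exceed [r], but it stays below [2 * r] as
     [a <= r + 1]. The factor [a - 1 >= 2] then puts the second term below half of [a ^ s.+1]. *)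
  have [a3|a3] := leqP 3 a.
    have ar : a <= r.+1.
      rewrite -ltnS -(@ltn_pmul2r (r + 1)) ?addn1 //.
      by move: an nr; rewrite -mulnn; nia.
    have kr : (n - 2 - a * r).+1 < 2 ^ s.+2 by rewrite expnS; nia.
    have v := hfun_bound (ltnW (ltnW a3)) kr.
    have v2 : 2 * hfun a (n - 2 - a * r) <= a.-1 * hfun a (n - 2 - a * r).
      by rewrite leq_mul2r; apply/orP; right; lia.
    lia.
  have kr : n - 2 - a * r < r by nia.
  have /andP[v1 v2] := bound _ kr.
  lia.
have /andP[_ u2] := bound (r - 2) ltac:(lia).
have /andP[v1 v2] : hfun a (minn (n - 3 - a * (r - 1)) (r - 2)) <=
    (a - 1) * hfun a (minn (n - 3 - a * (r - 1)) (r - 2)) < a ^ s.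
  by apply: bound; rewrite gtn_min; apply/orP; right; lia.
lia.
Qed.

End HfunBounds.

(* Additional points for small [r], and conclusion *)
Local Close Scope ring_scope.

Lemma count_word_set_le r a t (x : {ffun 'I_t -> 'I_a}) (s J : seq nat) :
  (forall i, i < r.+1 -> i * a + letter x i \in s -> i \in J) ->
  count (mem s) (word_set r x) <= size J.
Proof.
move=> sJ; rewrite count_word_set -size_filter.
apply: uniq_leq_size; first by rewrite filter_uniq ?iota_uniq.
by move=> i; rewrite mem_filter mem_iota add0n => /andP[si /andP[_ ir]]; apply: sJ.
Qed.

(** A word has at most one element in each block of length [a]. *)
Lemma count_word_set_block r a t (x : {ffun 'I_t -> 'I_a}) (s : seq nat) l m : 0 < a ->
  all (fun y => l * a <= y < (l + m) * a) s -> count (mem s) (word_set r x) <= m.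
Proof.
move=> a0 /allP sP; rewrite -[X in _ <= X](size_iota l).
apply: count_word_set_le => i _ /sP; rewrite mem_iota.
rewrite -leq_divRL // -ltn_divLR // divnMDl //.
by rewrite divn_small ?addn0 // letter_lt.
Qed.

Lemma letter_pair a (x : {ffun 'I_1 -> 'I_a}) i : 0 < a -> i < 4 ->
  letter x i = if i == 3 then 0 else x ord0.
Proof.
move=> a0; case: i => [|[|[|[|i]]]] //= _; rewrite /letter.
- by rewrite insubT //=; congr (nat_of_ord (x _)); apply: val_inj.
- by rewrite insubT //=; congr (nat_of_ord (x _)); apply: val_inj.
- by rewrite insubF //= big_ord1 modn_small ?ltn_ord.
by rewrite insubF.
Qed.

Section SmallCases.
Variables (R : realType) (n a : nat).
Hypothesis a2 : 2 <= a.

(** The additional index set lies in three blocks, so it meets a word in at most [3 = r - 2]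
    elements. *)
Lemma not_defective_r5 h : 6 * a <= n.+1 -> h <= a ^ 2 ->
  ~ defective h.+1 (grassmannian R 5 n).
Proof.
move=> an ha.
apply: (@not_defective_words 5 n a 2 _ _ _ R [:: [:: 0; 1; a; a.+1; 2 * a; (2 * a).+1]]) => //.
- by lia.
- by lia.
- by lia.
- by rewrite /= addn1.
- by move=> s; rewrite inE => /eqP->; split=> //=; rewrite ?inE; lia.
move=> x s; rewrite inE => /eqP->; rewrite addn2 !ltnS.
by apply: (@count_word_set_block _ _ _ _ _ 0) => /=; lia.
Qed.

(** The two additional index sets lie in two blocks each, with no block in common. *)
Lemma not_defective_r4 h : 5 * a <= n.+1 -> 3 <= a -> h <= (a ^ 2).+1 ->
  ~ defective h.+1 (grassmannian R 4 n).
Proof.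
move=> an a3 ha; pose E1 := [:: 0; 1; 2; a; a.+1].
pose E2 := [:: 2 * a; (2 * a).+1; (2 * a).+2; 3 * a; (3 * a).+1].
have b1 : all (fun y => 0 * a <= y < (0 + 2) * a) E1 by rewrite /=; lia.
have b2 : all (fun y => 2 * a <= y < (2 + 2) * a) E2 by rewrite /=; lia.
apply: (@not_defective_words 4 n a 2 _ _ _ R [:: E1; E2]) => //.
- by lia.
- by lia.
- by lia.
- by rewrite /= addn2.
- move=> s; rewrite !inE => /orP[]/eqP->; split=> //=; rewrite ?inE; lia.
- move=> x s; rewrite !inE => /orP[]/eqP->; rewrite addn2 !ltnS.
    by apply: (@count_word_set_block _ _ _ _ _ _ _ _ b1); lia.
  by apply: (@count_word_set_block _ _ _ _ _ _ _ _ b2); lia.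
suff c0 : count (mem E2) E1 = 0 by rewrite pairwise_cons all_seq1 c0.
apply/eqP; rewrite -leqn0 leqNgt -has_count; apply/hasPn => y /(allP b1) y1.
by apply/negP => /(allP b2) y2; lia.
Qed.

(** The additional index set has letters 0, 1, 2, 1, so a word [c c c 0] can agree with it only at
    position [c]. *)
Lemma not_defective_r3 h : 4 * a <= n.+1 -> 3 <= a -> h <= a ->
  ~ defective h.+1 (grassmannian R 3 n).
Proof.
move=> an a3 ha.
apply: (@not_defective_words 3 n a 1 _ _ _ R [:: [:: 0; a.+1; (2 * a).+2; (3 * a).+1]]) => //.
- by lia.
- by lia.
- by lia.
- by rewrite /= addn1 expn1.
- by move=> s; rewrite inE => /eqP->; split=> //=; rewrite ?inE; lia.
move=> x s; rewrite inE => /eqP->; rewrite addn2 !ltnS.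
apply: (@count_word_set_le _ _ _ _ _ [:: x ord0 : nat]) => i i4.
rewrite letter_pair //; last by lia.
have := ltn_ord (x ord0); move: (nat_of_ord (x ord0)) => c ca.
by case: i i4 => [|[|[|[|i]]]] //= _; rewrite !inE; lia.
Qed.

(** 3 and 6 lie in blocks 1 and 2; either [b] lies in a third block, or [a <= 2] and block 2 is
    beyond the blocks in use. *)
Lemma not_defective_extra_plane b : 3 * a <= n.+1 -> 7 <= b <= n ->
  9 <= b \/ a <= 2 -> ~ defective a.+1 (grassmannian R 2 n).
Proof.
move=> an /andP[b7 bn] ba.
pose q (i : 'I_3) : 'I_n.+1 := inord (nth 0 [:: 3; 6; b] i).
have qE i : q i = nth 0 [:: 3; 6; b] i :> nat.
  by rewrite /q inordK //; case: i => [[|[|[|i]]] //= _]; lia.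
apply: (@not_defective_planes R n a q) => //.
- exact: ltnW.
- move=> i j /(congr1 (@nat_of_ord _)); rewrite !qE => ij; apply: val_inj.
  by move: i j ij => [[|[|[|i]]] //= _] [[|[|[|j]]] //= _]; lia.
- by move=> i; rewrite qE; case: i => [[|[|[|i]]] //= _]; lia.
move=> i j; rewrite -val_eqE !qE.
by move: i j => [[|[|[|i]]] //= _] [[|[|[|j]]] //= _]; lia.
Qed.

Lemma hfun_le3 k : k <= 3 -> hfun a k <= a.
Proof.
by case: k => [|[|[|[|k]]]] // _; rewrite ?hfun0 ?hfun1 ?hfun2 ?hfun3 // ltnW.
Qed.

Lemma hfun_le6 k : k <= 6 -> hfun a k <= a.+1.
Proof.
move=> k6; have [/hfun_le3/leqW //|k3] := leqP k 3.
have : k = 4 \/ k = 5 \/ k = 6 by lia.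
by case=> [->|[->|->]]; rewrite ?hfun4 ?hfun5 ?hfun6.
Qed.

End SmallCases.

Theorem theorem5p4 (R : realType) (r n h : nat) (hr : 2 <= r)
    (hn : 2 * r + 1 <= n) :
  let alpha := (n + 1) %/ (r + 1) in
  (r ^ 2 + 3 * r + 1 <= n /\ h <= alpha * hfun alpha (r - 1))
  \/ [/\ n < r ^ 2 + 3 * r + 1, ~~ odd r &
        h <= (alpha - 1) * hfun alpha (r - 1) + hfun alpha (n - 2 - alpha * r)]
  \/ [/\ n < r ^ 2 + 3 * r + 1, odd r &
        h <= (alpha - 1) * hfun alpha (r - 2)
             + hfun alpha (minn (n - 3 - alpha * (r - 1)) (r - 2))] ->
  ~ defective (h + 1) (grassmannian R r n).
Proof.
move=> a H; rewrite addn1.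
have a2 : 2 <= a by rewrite leq_divRL; lia.
have an : a * r.+1 <= n.+1 by rewrite -(addn1 r) -(addn1 n); apply: leq_trunc_div.
have na : n.+1 < a.+1 * r.+1 by rewrite -(addn1 r) -(addn1 n); apply: ltn_ceil; lia.
have h_lt : h < a ^ (trunc_log 2 r).+1 by apply: secant_bound_lt_pow.
clearbody a.
have rn : r <= n by lia.
have words t E (tr : 2 * t <= r) := @not_defective_words r n a t (ltnW a2) an tr R E h.+1 rn.
have [r6|] := leqP 6 r.
  have /andP[rs _] := @trunc_log_bounds 2 r isT (ltnW hr).
  (* With [s = trunc_log 2 r], doubling [s + 1] letters needs [2 * (s + 1) <= r]: for [s <= 2] this
     follows from [r >= 6], and for larger [s] from [2 * (s + 1) <= 2 ^ s]. *)
  apply: (words (trunc_log 2 r).+1 [::]) => //.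
    move: (trunc_log 2 r) rs => s; case: (leqP s 2) => [|s3] rs; first by lia.
    apply: leq_trans rs; elim: s s3 => // s IHs; rewrite ltnS leq_eqVlt.
    by case/predU1P => [<- //|/IHs]; rewrite expnS; lia.
  by rewrite addn0.
(* Now only [r %/ 2] letters fit, and [h + 1] may exceed the number of words by one, or by two if
   [r = 4]. *)
move=> r5; have [e|[e|[e|e]]] : r = 2 \/ r = 3 \/ r = 4 \/ r = 5 by lia.
- subst r; have h1 k : k <= 2 -> hfun a k <= 1.
    by case: k => [|[|[|k]]] // _; rewrite ?hfun0 ?hfun1 ?hfun2.
  have ha : h <= a.
    move: H; rewrite hfun1; case=> [[_]|[[n11 _]|[_ //]]]; first by rewrite muln1.
    by have := h1 (n - 2 - a * 2); lia.
  have [h_a|a_h] := ltnP h a.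
    by apply: (words 1 [::]) => //; rewrite /= ?addn0 ?expn1 //; lia.
  have {ha a_h} e : h = a by lia.
  subst h.
  (* For small [n], [h = a] forces [n - 2 - 2 * a] to be positive, which leaves only [n = 7] below
     9. *)
  have n9 : 9 <= n \/ n = 7 /\ a = 2.
    move: H; rewrite hfun1; case=> [[n11 _]|[[n11 _ ha]|[_ //]]]; first by lia.
    have k0 : n - 2 - a * 2 <> 0 by move=> k0; rewrite k0 hfun0 in ha; lia.
    by lia.
  by case: n9 => [n9|[n7 a2']]; [apply: (@not_defective_extra_plane _ _ _ a2 9)
    |apply: (@not_defective_extra_plane _ _ _ a2 7)]; lia.
- subst r; have ha : h <= a /\ (n = 7 -> h <= 1).
    have k1 k : hfun a (minn k 1) <= (0 < k).
      case: k => [|k]; first by rewrite min0n hfun0.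
      by rewrite (_ : minn k.+1 1 = 1) ?hfun1 //; lia.
    move: H; rewrite hfun2 hfun1; case=> [[n19 h_le]|[[_ //]|[n19 _ h_le]]]; first by lia.
    have := leq_trans h_le (leq_add (leqnn _) (k1 _)).
    by rewrite muln1; case: ltnP; lia.
  case: ha => ha ha7; have [a3|a3] := leqP 3 a.
    by apply: not_defective_r3 ha; lia.
  have e : a = 2 by lia.
  subst a; have [n8|n8] := leqP 8 n; last by apply: (words 1 [::]); rewrite //=; lia.
  (* 8 is outside the four blocks of length two; the letters 0, 1 and 1 in blocks 0, 1 and 3 agree
     with [c c c 0] at position [c] only. *)
  apply: (words 1 [:: [:: 0; 3; 7; 8]]) => //.
  - by move=> s; rewrite inE => /eqP->; split=> //=; lia.
  move=> x s; rewrite inE => /eqP->; rewrite addn2 !ltnS.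
  apply: (@count_word_set_le _ _ _ _ _ [:: x ord0 : nat]) => i i4.
  rewrite letter_pair //.
  have := ltn_ord (x ord0); move: (nat_of_ord (x ord0)) => c ca.
  by case: i i4 => [|[|[|[|i]]]] //= _; rewrite !inE; lia.
- subst r; have [a3|a3] := leqP 3 a.
    apply: (@not_defective_r4 R n a) => //; first by lia.
    move: H; rewrite hfun3 -(mulnn a); case=> [[n29 ha]|[[n29 _ ha]|[_ //]]]; first by lia.
    have := hfun_le6 a2 (_ : n - 2 - a * 4 <= 6) => /(_ ltac:(lia)); nia.
  have e : a = 2 by lia.
  subst a; have [n12|n12] := leqP n 12.
    apply: (words 2 [::]) => //; rewrite /=.
    move: H; rewrite hfun3; case=> [[n29 ha]|[[n29 _ ha]|[_ //]]]; first by lia.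
    suff : hfun 2 (n - 2 - 2 * 4) <= 1 by lia.
    have : n - 2 - 2 * 4 <= 2 by lia.
    by case: (n - 2 - 2 * 4) => [|[|[|k]]] // _; rewrite ?hfun0 ?hfun1 ?hfun2.
  (* The five blocks of length two end at 9, so only position 0 can be shared with a word. *)
  apply: (words 2 [:: [:: 0; 10; 11; 12; 13]]) => //.
  - move: H; rewrite hfun3 /=; case=> [[n29 ha]|[[n29 _ ha]|[_ //]]]; first by lia.
    by have := hfun_le3 a2 (_ : n - 2 - 2 * 4 <= 3) => /(_ ltac:(lia)); lia.
  - by move=> s; rewrite inE => /eqP->; split=> //=; lia.
  move=> x s; rewrite inE => /eqP->; rewrite addn2 !ltnS.
  apply: (@leq_trans 1) => //; apply: (@count_word_set_le _ _ _ _ _ [:: 0]) => i i5.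
  have := letter_lt (isT : 0 < 2) x i; rewrite !inE; lia.
subst r; apply: (@not_defective_r5 R n a) => //; first by lia.
move: H; rewrite hfun3 hfun4 -(mulnn a); case=> [[_ //]|[[_ //]|[_ _ ha]]].
have := hfun_le3 a2 (geq_minr (n - 3 - a * (5 - 1)) (5 - 2)); nia.
Qed.
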